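(* Let $n\ge 1$ and $r\ge 0$ be integers, $m=n+r(2n+1)$, let $\nu>0$, and let $\sigma>0$ satisfy $(2n+1)\sigma^2\ge 6(\nu+1)\log(2n+1)$. Let $(q,p)\in\mathbb R^{2m+1}\times\mathbb R^{2m+1}$ be picked at random with respect to the Gaussian probability measure $P$, and set $v_q(0)=G^Tq$, $v_p(0)=G^Tp$, $v_0=\begin{bmatrix}v_q(0)\\ v_p(0)\end{bmatrix}$. Consider all solutions $(u,\pi)$, in the space of trigonometric polynomials of degree at most $m$, of the Klein-Gordon system $\partial_t u=\pi$, $\partial_t\pi=\partial_x^2u-u$ on $[0,2\pi]$ with periodic boundary conditions that satisfy the constraints $$\int_0^{2\pi}g_m(x-x_\alpha)u(x,0)\,dx=v_{q,\alpha}(0),\qquad \int_0^{2\pi}g_m(x-x_\alpha)\pi(x,0)\,dx=v_{p,\alpha}(0),\qquad \alpha=0,\dots,2n.$$ Then for every $t\ge 0$, $$\left|\left\langle\begin{pmatrix}u(x,t)\\ \pi(x,t)\end{pmatrix}\right\rangle_{exact}-\left\langle\begin{pmatrix}u(x,t)\\ \pi(x,t)\end{pmatrix}\right\rangle_{approx}\right|_A\le\frac{2.3\,t}{(2n+1)^\nu}$$ with $P$-probability greater than $1-(2n+1)^{-\nu}$.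
   Context: Function space and coordinates. All functions $u(\cdot,t),\pi(\cdot,t)$ are real trigonometric polynomials of degree at most $m$. Write $$u(x,t)=\frac{a_0}{\sqrt{2\pi}}+\sum_{k=1}^m\Big(a_k\frac{\cos kx}{\sqrt\pi}+b_k\frac{\sin kx}{\sqrt\pi}\Big),$$ and similarly $\pi(x,t)$ with coefficients $\alpha_k,\beta_k$. Set $q=(a_m,\dots,a_0,b_1,\dots,b_m)^T$ and $p=(\alpha_m,\dots,\alpha_0,\beta_1,\dots,\beta_m)^T$ in $\mathbb R^{2m+1}$; functions are identified with their coefficient vectors. With $\omega_k=\sqrt{k^2+1}$ and $\Lambda=\mathrm{diag}(\omega_m,\dots,\omega_1,\omega_0,\omega_1,\dots,\omega_m)$, the Klein-Gordon system becomes $$\frac{d}{dt}\begin{bmatrix}q\\ p\end{bmatrix}=L\begin{bmatrix}q\\ p\end{bmatrix},\qquad L=\begin{bmatrix}0&I\\ -\Lambda^2&0\end{bmatrix}.$$ Constraints. $x_\alpha=2\pi\alpha/(2n+1)$ for $\alpha=0,\dots,2n$, and $g_m(x)=\frac1{2\pi}\sum_{k=-m}^m e^{-k^2\sigma^2/4}e^{ikx}$. $G$ is the real $(2m+1)\times(2n+1)$ matrix (of rank $2n+1$) such that $(G^Tq)_\alpha=\int_0^{2\pi}g_m(x-x_\alpha)f(x)\,dx$ whenever $f$ is the trigonometric polynomial with coefficient vector $q$. Explicitly, the entry in column $\alpha$ of $G$ corresponding to $a_0$ is $\frac1{\sqrt{2\pi}}\cdot$ $1$, to be scaled consistently as $\frac{1}{\sqrt{2\pi}}$;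 that corresponding to $a_k$ ($k\ge1$) is $\frac1{\sqrt\pi}e^{-k^2\sigma^2/4}\cos(kx_\alpha)$, and that corresponding to $b_k$ is $\frac1{\sqrt\pi}e^{-k^2\sigma^2/4}\sin(kx_\alpha)$. The constraint for the pair $(q,p)$ is $\mathbf G^T\begin{bmatrix}q(0)\\ p(0)\end{bmatrix}=v_0$ with $\mathbf G=\begin{bmatrix}G&0\\ 0&G\end{bmatrix}$. Measure and norm. $A=\begin{bmatrix}\Lambda^2&0\\ 0&I\end{bmatrix}$; $P$ is the probability measure on $\mathbb R^{2(2m+1)}$ with density proportional to $e^{-\frac12 z^TAz}$, $z=\begin{bmatrix}q\\ p\end{bmatrix}$. The norm is $|z|_A=|A^{1/2}z|$ (Euclidean norm), so $|(u,\pi)|_A^2=\int_0^{2\pi}\pi^2+u_x^2+u^2\,dx$. Exact and approximate averages. Let $M=\mathbf G^TA^{-1}\mathbf G$ and $K=LA^{-1}$. The exact average is the mean at time $t$ of all solutions whose initial data satisfy $\mathbf G^Tz(0)=v_0$, with respect to $P$ restricted to that affine subspace and renormalized (i.e. conditioned); in coefficients $$\langle z(t)\rangle_{exact}=e^{tL}A^{-1}\mathbf GM^{-1}v_0.$$ The approximate average is $$\langle z(t)\rangle_{approx}=A^{-1}\mathbf GM^{-1}v(t),\qquad \dot v(t)=\mathbf G^TK\mathbf GM^{-1}v(t),\quad v(0)=v_0.$$ *)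

(* Defs.v *)
From HB Require Import structures.
From mathcomp Require Import all_boot all_order all_algebra.
From mathcomp Require Import complex.
From mathcomp Require Import all_classical all_reals all_analysis measurable_realfun.

Set Implicit Arguments.
Unset Strict Implicit.
Unset Printing Implicit Defensive.

Import Order.TTheory GRing.Theory Num.Theory.
Import numFieldNormedType.Exports.

Local Open Scope classical_set_scope.
Local Open Scope ring_scope.

(* Lebesgue measure on R^N, built by recursion on N as an iterated product;
   R^N is the type of N-tuples with its product sigma-algebra. *)
Section lebesgue_cons.
Context (R : realType) (N : nat).
Local Notation RR := (measurableTypeR R).
Variable mu : {sigma_finite_measure set (N.-tuple RR) -> \bar R}.

Definition tuple_cons (xw : (RR * N.-tuple RR)%type) : N.+1.-tuple RR :=
  [the N.+1.-tuple RR of xw.1 :: xw.2].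

Lemma measurable_tuple_cons : measurable_fun [set: _] tuple_cons.
Proof. exact: measurable_cons. Qed.

Definition lebesgue_cons (E : set (N.+1.-tuple RR)) : \bar R :=
  ((@lebesgue_measure R) \x mu)%E (tuple_cons @^-1` E).

Let lebesgue_cons0 : lebesgue_cons set0 = 0%E.
Proof. by rewrite /lebesgue_cons preimage_set0 measure0. Qed.

Let lebesgue_cons_ge0 E : (0 <= lebesgue_cons E)%E.
Proof. exact: measure_ge0. Qed.

Let preim_measurable E : measurable E -> measurable (tuple_cons @^-1` E).
Proof. by move=> mE; rewrite -[X in measurable X]setTI; exact: measurable_tuple_cons. Qed.

Let lebesgue_cons_sigma_additive : semi_sigma_additive lebesgue_cons.
Proof.
move=> F mF tF mUF; rewrite /lebesgue_cons preimage_bigcup.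
apply: measure_semi_sigma_additive.
- by move=> i; exact: preim_measurable.
- apply/trivIsetP => i j _ _ ij; rewrite -preimage_setI.
  by move/trivIsetP : tF => /(_ _ _ _ _ ij) -> //; rewrite preimage_set0.
- by rewrite -preimage_bigcup; exact: preim_measurable.
Qed.

HB.instance Definition _ := isMeasure.Build _ _ _ lebesgue_cons
  lebesgue_cons0 lebesgue_cons_ge0 lebesgue_cons_sigma_additive.

Let lebesgue_cons_sigma_finite : sigma_finite setT lebesgue_cons.
Proof.
have /sigma_finiteP[F [TF ndF Foo]] := sigma_finiteT (@lebesgue_measure R).
have /sigma_finiteP[G [TG ndG Goo]] := sigma_finiteT mu.
pose H k := [set w : N.+1.-tuple RR |
  F k (thead w) /\ G k [tuple of behead w]].
have preimH k : tuple_cons @^-1` H k = F k `*` G k.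
  apply/seteqP; split => -[x w] /=; rewrite /H/= theadE;
  by rewrite (_ : [tuple of _] = w)//; exact/val_inj.
exists H.
  apply/seteqP; split => // w _.
  have [i _ Fi] : (\bigcup_k F k) (thead w) by rewrite -TF.
  have [j _ Gj] : (\bigcup_k G k) [tuple of behead w] by rewrite -TG.
  exists (maxn i j) => //; split.
    by move: Fi; exact/subsetPset/ndF/leq_maxl.
  by move: Gj; exact/subsetPset/ndG/leq_maxr.
move=> k; have [mF Fk] := Foo k; have [mG Gk] := Goo k; split.
  apply: measurableI; rewrite -[X in measurable X]setTI.
    exact: (measurable_tnth ord0).
  exact: measurable_behead.
by rewrite /lebesgue_cons preimH product_measure1E// lte_mul_pinfty// ge0_fin_numE.
Qed.

HB.instance Definition _ := Measure_isSigmaFinite.Build _ _ _ lebesgue_cons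
  lebesgue_cons_sigma_finite.

End lebesgue_cons.

(* R^0 is a point and carries the unit mass. *)
Fixpoint lebesgue_tuple (R : realType) (N : nat) :
    {sigma_finite_measure set (N.-tuple (measurableTypeR R)) -> \bar R} :=
  match N with
  | 0 => [the {sigma_finite_measure set _ -> \bar R} of
          dirac [tuple of [::] : seq (measurableTypeR R)]]
  | N'.+1 => [the {sigma_finite_measure set _ -> \bar R} of
          lebesgue_cons (lebesgue_tuple R N')]
  end.

Definition cvec (R : realType) (N : nat) (w : N.-tuple (measurableTypeR R)) :
  'cV[R]_N := \col_i tnth w i.

Section gaussian.
Context (R : realType) (N : nat).
Local Notation RR := (measurableTypeR R).
Variable A : 'M[R]_N.

Definition gauss_weight (z : 'cV[R]_N) : R :=
  expR (- 2^-1 * (z^T *m A *m z) 0 0).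

Definition gauss_mass (E : set (N.-tuple RR)) : \bar R :=
  (\int[lebesgue_tuple R N]_(w in E) (gauss_weight (cvec w))%:E)%E.

Let measurable_gauss_weight :
  measurable_fun [set: N.-tuple RR] (gauss_weight \o @cvec R N).
Proof.
apply: measurableT_comp => //.
apply: measurable_funM => //.
under eq_fun do rewrite mxE.
apply: measurable_sum => j; apply: measurable_funM; last first.
  by under eq_fun do rewrite mxE; exact: measurable_tnth.
under eq_fun do rewrite mxE.
apply: measurable_sum => i; apply: measurable_funM => //.
by under eq_fun do rewrite !mxE; exact: measurable_tnth.
Qed.

Let gauss_mass0 : gauss_mass set0 = 0%E.
Proof. exact: integral_set0. Qed.

Let gauss_mass_ge0 E : (0 <= gauss_mass E)%E.
Proof. by apply: integral_ge0 => w _; rewrite lee_fin expR_ge0. Qed.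

Let gauss_mass_sigma_additive : semi_sigma_additive gauss_mass.
Proof.
apply: semi_sigma_additive_nng_induced; last first.
  by move=> w; rewrite lee_fin expR_ge0.
by apply/measurable_EFinP; exact: measurable_gauss_weight.
Qed.

HB.instance Definition _ := isMeasure.Build _ _ _ gauss_mass
  gauss_mass0 gauss_mass_ge0 gauss_mass_sigma_additive.

(* The Dirac mass is the fallback value of mnormalize, used only if the total
   mass is 0 or infinite; it is irrelevant when A is positive definite. *)
Definition gauss_prob : probability (N.-tuple RR) R :=
  mnormalize gauss_mass (dirac [tuple of nseq N (0 : RR)]).

(* y is the mean of f under the Gaussian weight restricted to the affine
   subspace S and renormalized. S is parametrized by w |-> c + B w with B of full
   column rank; the constant Jacobian of the parametrization cancels in the
   quotient, so the mean does not depend on the parametrization. *)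
Definition is_restricted_mean (S : set 'cV[R]_N) (f : 'cV[R]_N -> 'cV[R]_N)
    (y : 'cV[R]_N) : Prop :=
  exists (d : nat) (c : 'cV[R]_N) (B : 'M[R]_(N, d)),
    let z (w : d.-tuple RR) := c + B *m cvec w in
    [/\ \rank B = d, S = range z &
        forall i : 'I_N,
          y i 0 = (\int[lebesgue_tuple R d]_w (f (z w) i 0 * gauss_weight (z w)))
                  / (\int[lebesgue_tuple R d]_w gauss_weight (z w))].

Definition restricted_mean (S : set 'cV[R]_N) (f : 'cV[R]_N -> 'cV[R]_N) :
  'cV[R]_N := xget 0 [set y | is_restricted_mean S f y].

End gaussian.

Section klein_gordon.
Variable R : realType.

Section space.
Variable m : nat.

Definition coefs : Type := 'cV[R]_(2 * m).+1.

Definition phase : Type := 'cV[R]_((2 * m).+1 + (2 * m).+1).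

(* Coefficient vectors are ordered (a_m, ..., a_0, b_1, ..., b_m): index i < m
   is a cosine mode, i = m the constant mode, i > m a sine mode. *)
Definition wavenumber (i : 'I_(2 * m).+1) : nat :=
  if (i <= m)%N then (m - i)%N else (i - m)%N.

Definition trig_basis (i : 'I_(2 * m).+1) (x : R) : R :=
  if (i < m)%N then cos ((wavenumber i)%:R * x) / Num.sqrt pi
  else if i == m :> nat then (Num.sqrt (2 * pi))^-1
  else sin ((wavenumber i)%:R * x) / Num.sqrt pi.

Definition trig (q : coefs) (x : R) : R := \sum_i q i 0 * trig_basis i x.

Definition qpart (z : phase) : coefs := usubmx z.
Definition ppart (z : phase) : coefs := dsubmx z.

(* u_t = pi and pi_t = u_xx - u; trigonometric polynomials are 2 pi-periodic in
   x, so the periodic boundary conditions hold automatically. The time domain is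
   R rather than [0, +oo[: the system is linear with constant coefficients, so
   solutions extend uniquely. *)
Definition KG_solution (z : R -> phase) : Prop :=
  forall t x : R,
    is_derive t (1 : R) (fun s => trig (qpart (z s)) x) (trig (ppart (z t)) x) /\
    is_derive t (1 : R) (fun s => trig (ppart (z s)) x)
      (derive1n 2 (trig (qpart (z t))) x - trig (qpart (z t)) x).

Definition KG_flow (Phi : phase -> R -> phase) : Prop :=
  forall z0 : phase, Phi z0 0 = z0 /\ KG_solution (Phi z0).

Definition omega (k : nat) : R := Num.sqrt (k%:R ^+ 2 + 1).

Definition Lambda : 'M[R]_((2 * m).+1) := diag_mx (\row_i omega (wavenumber i)).

Definition Lmx : 'M[R]_((2 * m).+1 + (2 * m).+1) :=
  block_mx 0 1%:M (- (Lambda *m Lambda)) 0.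

Definition Amx : 'M[R]_((2 * m).+1 + (2 * m).+1) :=
  block_mx (Lambda *m Lambda) 0 0 1%:M.

Definition Amx_sqrt : 'M[R]_((2 * m).+1 + (2 * m).+1) :=
  block_mx Lambda 0 0 1%:M.

Definition normA (z : phase) : R :=
  Num.sqrt (\sum_i ((Amx_sqrt *m z) i 0) ^+ 2).

Definition KG_prob :
    probability (((2 * m).+1 + (2 * m).+1).-tuple (measurableTypeR R)) R :=
  gauss_prob Amx.

End space.

Section constraints.
Variables (m n : nat) (sigma : R).

Definition obs : Type := 'cV[R]_((2 * n).+1 + (2 * n).+1).

Definition gridpt (al : 'I_(2 * n).+1) : R :=
  2 * pi * al%:R / (2 * n).+1%:R.

(* The term of index j is the one of frequency k = j - m. The sum is real, and
   complex.Re merely converts it to R. *)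
Definition gker (x : R) : R :=
  complex.Re ((2 * pi)^-1%:C * \sum_(j < (2 * m).+1)
    let k : R := j%:R - m%:R in
    (expR (- (k ^+ 2 * sigma ^+ 2 / 4)))%:C * (cos (k * x) +i* sin (k * x)))%C.

Definition kernel_average (q : coefs m) (al : 'I_(2 * n).+1) : R :=
  \int[lebesgue_measure]_(x in `[0, 2 * pi]) (gker (x - gridpt al) * trig q x).

Definition constrained (v0 : obs) : set (phase m) :=
  [set z | forall al : 'I_(2 * n).+1,
     kernel_average (qpart z) al = usubmx v0 al 0 /\
     kernel_average (ppart z) al = dsubmx v0 al 0].

Definition Gmx : 'M[R]_((2 * m).+1, (2 * n).+1) :=
  \matrix_(i, al)
    (expR (- ((wavenumber i)%:R ^+ 2 * sigma ^+ 2 / 4)) * trig_basis i (gridpt al)).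

Definition GGmx :
    'M[R]_((2 * m).+1 + (2 * m).+1, (2 * n).+1 + (2 * n).+1) :=
  block_mx Gmx 0 0 Gmx.

Definition Mmx : 'M[R]_((2 * n).+1 + (2 * n).+1) :=
  GGmx^T *m invmx (Amx m) *m GGmx.

Definition Kmx : 'M[R]_((2 * m).+1 + (2 * m).+1) := Lmx m *m invmx (Amx m).

Definition exact_average (Phi : phase m -> R -> phase m) (v0 : obs) (t : R) :
  phase m := restricted_mean (Amx m) (constrained v0) (fun z => Phi z t).

Definition approx_evolution (v0 : obs) (v : R -> obs) : Prop :=
  v 0 = v0 /\
  forall (t : R) i,
    is_derive t (1 : R) (fun s => v s i 0)
      ((GGmx^T *m Kmx *m GGmx *m invmx Mmx *m v t) i 0).

Definition approx_average (vt : obs) : phase m :=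
  invmx (Amx m) *m GGmx *m invmx Mmx *m vt.

End constraints.
End klein_gordon.

(* Main.v *)
Require Import Defs.
From HB Require Import structures.
From mathcomp Require Import all_boot all_order all_algebra.
From mathcomp Require Import complex ring lra zify.
From mathcomp Require Import all_classical all_reals all_analysis measurable_realfun.

Set Implicit Arguments.
Unset Strict Implicit.
Unset Printing Implicit Defensive.

Import Order.TTheory GRing.Theory Num.Theory.
Import numFieldNormedType.Exports.

Local Open Scope classical_set_scope.
Local Open Scope ring_scope.

(* Write N = 2n+1, and let C be the matrix of the observations, A = D^T D the
   energy form, M = C^T A^-1 C. The conditional mean of the initial data is
   A^-1 C M^-1 v_0, because the reflection through this point preserves both the
   affine subspace and the restricted Gaussian weight. The error e(t) between the
   two averages satisfies e' = L e + r, where L is skew for the energy and r is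
   the residual of the A-orthogonal projection of K C M^-1 v onto the range of
   A^-1 C; hence |e(t)|_A <= t sup |r|_A. The least-squares property of r bounds
   |r|_A by any explicit choice: cancelling the modes of frequency at most n
   leaves only their aliases on the grid, whose damping relative to the mode they
   alias is exp(-(k^2 - l^2) sigma^2 / 2) with k^2 - l^2 >= N (k - n). This gives
   |r|_A^2 <= (16/3) N exp(-N sigma^2 / 2) H, where H = v^T M^-1 v is conserved
   by the approximate evolution. Under P the mean of H(0) is 2N, and Markov's
   inequality concludes. *)

(** * Integration on tuples *)

(** Two obstacles shape the proof. [restricted_mean] is a choice over all affine parametrizations of
    the constraint set, so its value must be computed for each of them. In the parameters the
    reflection reads [w -> 2 ws - w], hence Lebesgue measure only has to be invariant under
    coordinatewise translations and sign changes. Secondly, the good event is not shown to be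
    measurable; it is bounded below through a measurable sublevel set of the quadratic form [H]. The
    map [exp (t L)] is never formed: the energy estimate gives uniqueness of solutions, and
    uniqueness makes the flow linear at each time. Accounting of the constants: the width condition
    gives [exp (- N sigma^2 / 2) <= N^-3 * N^(-3 nu)]. Two factors [N^-nu] pay for the squared error
    and the third for the probability. One power of [N] cancels the [N] of the residual, one cancels
    the mean of [H], and the last, with [N >= 3], absorbs the numerical factors, among them a loss
    of [6 / 5] from an approximate second moment. What remains is [64 / (5 * 2.3^2 * N) < 1]. *)

Section lebesgue_tuple_integral.
Context {R : realType}.
Local Notation RR := (measurableTypeR R).
Local Notation leb := (@lebesgue_measure R).

Lemma integral_gaussian (c a : R) : 0 < c ->
  (\int[leb]_x (expR (- c * (x - a) ^+ 2))%:E = (Num.sqrt (pi / c))%:E)%E.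
Proof.
(* The standard deviation for which the normal density has exponent [- c (x - a)^2]. *)
move=> c0; pose s : R := (Num.sqrt (2 * c))^-1.
have c20 : 0 < 2 * c by rewrite mulr_gt0.
have s0 : s != 0 by rewrite invr_neq0// gt_eqF// sqrtr_gt0.
have s2 : s ^+ 2 = (2 * c)^-1 by rewrite exprVn sqr_sqrtr// ltW.
have pk : s ^+ 2 * pi *+ 2 = pi / c :> R.
  by rewrite s2 -mulr_natr; field; rewrite gt_eqF.
have pc0 : 0 < pi / c :> R by rewrite divr_gt0// pi_gt0.
have := @integral_normal_pdf R a s.
rewrite /normal_pdf (negbTE s0) => H.
transitivity (\int[leb]_x ((Num.sqrt (pi / c))%:E *
    (normal_peak s * normal_fun a s x)%:E))%E.
  apply: eq_integral => x _; rewrite -EFinM; congr EFin.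
  rewrite /normal_peak pk mulVKf ?gt_eqF ?sqrtr_gt0//.
  rewrite /normal_fun s2; congr expR; rewrite -mulr_natr; field.
  by rewrite gt_eqF.
rewrite ge0_integralZl//; first by rewrite H mule1.
- apply/measurable_EFinP; apply: measurable_funM => //.
  exact: measurable_normal_fun.
- by move=> x _; rewrite lee_fin mulr_ge0 ?normal_peak_ge0 ?normal_fun_ge0.
Qed.

(** [lebesgue_cons] is by construction the image of a product measure under [tuple_cons], so a
    change of variables followed by Tonelli applies. *)
Lemma integral_lebesgue_tupleS N (f : N.+1.-tuple RR -> \bar R) :
  measurable_fun [set: _] f -> (forall w, 0 <= f w)%E ->
  (\int[lebesgue_tuple R N.+1]_w f w =
   \int[leb]_x \int[lebesgue_tuple R N]_w f (tuple_cons (x, w)))%E.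
Proof.
move=> mf f0.
transitivity (\int[leb \x lebesgue_tuple R N]_z (f \o @tuple_cons R N) z)%E.
  rewrite -[RHS](_ : \int[pushforward (leb \x lebesgue_tuple R N)%E
      (@tuple_cons R N)]_z f z = _)%E; last first.
    rewrite ge0_integral_pushforward//; exact: measurable_tuple_cons.
  pose mT := isMeasurableFun.Build _ _ _ _ _ (@measurable_tuple_cons R N).
  pose phi : {mfun _ >-> _} := HB.pack (@tuple_cons R N) mT.
  apply: (@eq_measure_integral _ _ _ _ [the {measure set _ -> \bar R} of
    pushforward (leb \x lebesgue_tuple R N)%E phi]).
  by move=> A mA _.
rewrite fubini_tonelli1//; last by move=> x; exact: f0.
by apply: measurableT_comp => //; exact: measurable_tuple_cons.
Qed.

Lemma measurable_tupleS_section N (f : N.+1.-tuple RR -> \bar R) (x : RR) :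
  measurable_fun [set: _] f ->
  measurable_fun [set: N.-tuple RR] (fun w => f (tuple_cons (x, w))).
Proof.
move=> mf; apply: measurableT_comp => //.
by apply: measurableT_comp; [exact: measurable_tuple_cons|exact: measurable_pair1].
Qed.

Lemma integral_lebesgue_tuple0 (f : 0.-tuple RR -> \bar R) :
  measurable_fun [set: _] f ->
  (\int[lebesgue_tuple R 0]_w f w = f [tuple])%E.
Proof.
move=> mf; rewrite integral_dirac//= diracT mul1e.
by congr f; apply: val_inj.
Qed.

Lemma measurable_fun_ptuple N (g : 'I_N -> RR -> R) :
  (forall i, measurable_fun [set: RR] (g i)) ->
  measurable_fun [set: N.-tuple RR] (fun w => \prod_i g i (tnth w i)).
Proof.
move=> mg; apply: measurable_prod => i _.
by apply: (@measurableT_comp _ _ _ _ _ _ (g i)) => //; exact: measurable_tnth.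
Qed.

(** Induction that integrates out the head coordinate; every integral of a diagonal Gaussian below
    is evaluated through it. *)
Lemma integral_tuple_prod N (g : 'I_N -> RR -> R) (I : 'I_N -> R) :
  (forall i, measurable_fun [set: RR] (g i)) -> (forall i x, 0 <= g i x) ->
  (forall i, \int[leb]_x (g i x)%:E = (I i)%:E)%E ->
  (\int[lebesgue_tuple R N]_w (\prod_i g i (tnth w i))%:E = (\prod_i I i)%:E)%E.
Proof.
elim: N g I => [|N IH] g I mg g0 gI.
  rewrite integral_lebesgue_tuple0 ?big_ord0//.
  by apply/measurable_EFinP; exact: measurable_fun_ptuple.
rewrite integral_lebesgue_tupleS; last 2 first.
- by apply/measurable_EFinP; exact: measurable_fun_ptuple.
- by move=> w; rewrite lee_fin prodr_ge0.
transitivity (\int[leb]_x ((g ord0 x)%:E * (\prod_i I (lift ord0 i))%:E))%E.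
  apply: eq_integral => x _.
  rewrite -(IH (fun i => g (lift ord0 i)))// -ge0_integralZl//; last 3 first.
  - apply/measurable_EFinP.
    exact: (@measurable_fun_ptuple _ (fun i => g (lift ord0 i))).
  - by move=> w _; rewrite lee_fin prodr_ge0.
  - by rewrite lee_fin.
  apply: eq_integral => w _; rewrite -EFinM big_ord_recl /=; congr (_ * _)%:E.
  by apply: eq_bigr => i _; congr (g _ _); rewrite tnthS.
rewrite ge0_integralZr//; last 3 first.
- by apply/measurable_EFinP.
- by move=> x _; rewrite lee_fin.
- rewrite lee_fin prodr_ge0// => i _.
  by rewrite -lee_fin -gI integral_ge0// => x _; rewrite lee_fin.
by rewrite gI -EFinM big_ord_recl.
Qed.

(** General enough for the two symmetries in use: reflection through a point (all signs negative,
    [a] twice the point) and the sign change of a single coordinate. Being coordinatewise, it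
    preserves Lebesgue measure by induction on [N], without any determinant. *)
Definition affine_flip N (a : 'I_N -> R) (s : 'I_N -> bool) (w : N.-tuple RR) :
  N.-tuple RR := [tuple a i + (-1) ^+ s i * tnth w i | i < N].

Lemma measurable_flip (a : R) (b : bool) :
  measurable_fun [set: RR] (fun x : RR => a + (-1) ^+ b * x : RR).
Proof. by apply: measurable_funD => //; apply: measurable_funM. Qed.

Lemma measurable_affine_flip N a s : measurable_fun [set: _] (@affine_flip N a s).
Proof.
apply/measurable_fun_tnthP => i.
rewrite (_ : _ \o _ = fun w => a i + (-1) ^+ s i * tnth w i); last first.
  by apply/funext => w /=; rewrite tnth_mktuple.
by apply: measurableT_comp (@measurable_flip _ _) _; exact: measurable_tnth.
Qed.

Lemma lebesgue_measure_flip (a : R) (b : bool) (E : set RR) : measurable E ->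
  leb E = pushforward leb (fun x : RR => a + (-1) ^+ b * x : RR) E.
Proof.
move: E; have mf := measurable_flip a b.
pose mfT := isMeasurableFun.Build _ _ _ _ _ mf.
pose phi : {mfun RR >-> RR} := HB.pack (fun x : RR => a + (-1) ^+ b * x : RR) mfT.
apply: (@lebesgue_measure_unique R [the {measure set _ -> \bar R} of pushforward leb phi]).
move=> X [[x y] _ <-] /=.
rewrite /pushforward /=.
case: b mf mfT phi => mf mfT phi.
  (* The reflection exchanges the open and the closed end, which does not change the length. *)
  rewrite (_ : _ @^-1` _ = `[a - y, a - x[%classic); last first.
    apply/seteqP; split => z /=; rewrite !in_itv/= expr1 => /andP[h1 h2];
    apply/andP; split; lra.
  rewrite !lebesgue_measure_itv/= !lte_fin ltrBlDr.
  rewrite (_ : (a < a - x + y) = (x < y)); last by apply/idP/idP; lra.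
  by case: ifP => // _; rewrite -!EFinD; congr EFin; lra.
rewrite (_ : _ @^-1` _ = `]x - a, y - a]%classic); last first.
  apply/seteqP; split => z /=; rewrite !in_itv/= expr0 => /andP[h1 h2];
  apply/andP; split; lra.
rewrite !lebesgue_measure_itv/= !lte_fin.
rewrite (_ : (x - a < y - a) = (x < y)); last by apply/idP/idP; lra.
by case: ifP => // _; rewrite -!EFinD; congr EFin; lra.
Qed.

Lemma integral_flip (a : R) (b : bool) (f : RR -> \bar R) :
  measurable_fun [set: _] f -> (forall x, 0 <= f x)%E ->
  (\int[leb]_x f (a + (-1) ^+ b * x)%R = \int[leb]_x f x)%E.
Proof.
move=> mf f0; rewrite -[LHS](_ : \int[pushforward leb
  (fun x : RR => (a + (-1) ^+ b * x)%R : RR)]_x f x = _)%E; last first.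
  rewrite ge0_integral_pushforward//; exact: measurable_flip.
have mphi := measurable_flip a b.
pose mfT := isMeasurableFun.Build _ _ _ _ _ mphi.
pose phi : {mfun RR >-> RR} := HB.pack (fun x : RR => a + (-1) ^+ b * x : RR) mfT.
symmetry.
apply: (@eq_measure_integral _ _ _ _ [the {measure set _ -> \bar R} of pushforward leb phi]).
by move=> A mA _; exact: lebesgue_measure_flip.
Qed.

Lemma affine_flip_cons N (a : 'I_N.+1 -> R) (s : 'I_N.+1 -> bool) x w :
  affine_flip a s (tuple_cons (x, w)) =
  tuple_cons (a ord0 + (-1) ^+ s ord0 * x,
    affine_flip (fun i => a (lift ord0 i)) (fun i => s (lift ord0 i)) w).
Proof.
apply: eq_from_tnth => i; rewrite tnth_mktuple.
have [j ->|->] := unliftP ord0 i; last by rewrite !tnth0.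
by rewrite !tnthS tnth_mktuple.
Qed.

Lemma ge0_integral_affine_flip N a s (f : N.-tuple RR -> \bar R) :
  measurable_fun [set: _] f -> (forall w, 0 <= f w)%E ->
  (\int[lebesgue_tuple R N]_w f (affine_flip a s w) =
   \int[lebesgue_tuple R N]_w f w)%E.
Proof.
elim: N a s f => [|N IH] a s f mf f0.
  apply: eq_integral => w _; congr f; apply: eq_from_tnth => -[] //.
rewrite integral_lebesgue_tupleS//; last first.
  by apply: measurableT_comp => //; exact: measurable_affine_flip.
under eq_integral => x _ do under eq_integral => w _ do rewrite affine_flip_cons.
under eq_integral => x _.
  rewrite (IH _ _ (fun w => f (tuple_cons (_, w))))//; last first.
    exact: measurable_tupleS_section.
  over.
rewrite [RHS]integral_lebesgue_tupleS//.
pose F (x : RR) := (\int[lebesgue_tuple R N]_w f (tuple_cons (x, w)))%E.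
rewrite (@integral_flip _ _ F)//.
  apply: (@measurable_fun_fubini_tonelli_F _ _ _ _ _ _ (f \o @tuple_cons R N)) => //.
  - by apply: measurableT_comp => //; exact: measurable_tuple_cons.
  - by move=> x; exact: f0.
by move=> x; apply: integral_ge0 => w _; exact: f0.
Qed.

End lebesgue_tuple_integral.

Section finite_sums.
Context {R : realType}.

(** Expanding the sum of the squares [(B a_i - D b_i)^2] gives [B (A B - D^2) >= 0]; cancelling [B]
    forces the separate case [B = 0]. *)
Lemma cauchy_schwarz_sum (I : finType) (a b : I -> R) :
  (\sum_i a i * b i) ^+ 2 <= (\sum_i a i ^+ 2) * (\sum_i b i ^+ 2).
Proof.
set D := \sum_i a i * b i; set B := \sum_i b i ^+ 2; set A := \sum_i a i ^+ 2.
have B0 : 0 <= B by apply: sumr_ge0 => i _; exact: sqr_ge0.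
have [B_eq0|Bn0] := eqVneq B 0.
  have b0 i : b i = 0.
    have /(_ i isT)/eqP := psumr_eq0P (fun i _ => sqr_ge0 (b i)) B_eq0.
    by rewrite sqrf_eq0 => /eqP.
  by rewrite /D big1 ?expr0n ?B_eq0 ?mulr0// => i _; rewrite b0 mulr0.
have Bp : 0 < B by rewrite lt_neqAle eq_sym Bn0.
have : 0 <= \sum_i (B * a i - D * b i) ^+ 2.
  by apply: sumr_ge0 => i _; exact: sqr_ge0.
have -> : \sum_i (B * a i - D * b i) ^+ 2 = B * (A * B - D ^+ 2).
  rewrite (eq_bigr (fun i => B ^+ 2 * a i ^+ 2 - (B * D *+ 2) * (a i * b i)
     + D ^+ 2 * b i ^+ 2)); last by move=> i _; ring.
  rewrite big_split sumrB/= -!mulr_sumr -/A -/B -/D; ring.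
by rewrite pmulr_rge0// subr_ge0.
Qed.

End finite_sums.

Definition sqnorm {R : realType} {N : nat} (z : 'cV[R]_N) : R :=
  \sum_i z i 0 ^+ 2.

Section sqnorm.
Context {R : realType}.

Lemma sqnorm_ge0 N (z : 'cV[R]_N) : 0 <= sqnorm z.
Proof. by apply: sumr_ge0 => i _; exact: sqr_ge0. Qed.

Lemma sqnormE N (z : 'cV[R]_N) : sqnorm z = (z^T *m z) 0 0.
Proof. by rewrite mxE; apply: eq_bigr => i _; rewrite mxE expr2. Qed.

Lemma sqnorm_eq0 N (z : 'cV[R]_N) : sqnorm z = 0 -> z = 0.
Proof.
move=> z0; apply/colP => i; rewrite mxE.
have /(_ i isT)/eqP := psumr_eq0P (fun i _ => sqr_ge0 (z i 0)) z0.
by rewrite sqrf_eq0 => /eqP.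
Qed.

Lemma sqr_mulmx_le M N (B : 'M[R]_(M, N)) (z : 'cV[R]_N) i :
  (B *m z) i 0 ^+ 2 <= (\sum_j B i j ^+ 2) * sqnorm z.
Proof. by rewrite mxE; exact: cauchy_schwarz_sum. Qed.

Lemma sqnorm_mulmx_le M N (B : 'M[R]_(M, N)) (z : 'cV[R]_N) :
  sqnorm (B *m z) <= (\sum_i \sum_j B i j ^+ 2) * sqnorm z.
Proof. by rewrite mulr_suml; apply: ler_sum => i _; exact: sqr_mulmx_le. Qed.

End sqnorm.

Section tuple_integrable.
Context {R : realType}.
Local Notation RR := (measurableTypeR R).

Lemma integral_affine_flip N a s (f : N.-tuple RR -> \bar R) :
  measurable_fun [set: _] f ->
  (\int[lebesgue_tuple R N]_w f (affine_flip a s w) =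
   \int[lebesgue_tuple R N]_w f w)%E.
Proof.
move=> mf; rewrite integralE [RHS]integralE; congr (_ - _)%E.
  have f0 w : (0 <= f^\+ w)%E by exact: funepos_ge0.
  rewrite -[RHS](ge0_integral_affine_flip a s (measurable_funepos mf) f0).
  by apply: eq_integral => w _; rewrite -/((f \o affine_flip a s)^\+ w)%E funepos_comp.
have f0 w : (0 <= f^\- w)%E by exact: funeneg_ge0.
rewrite -[RHS](ge0_integral_affine_flip a s (measurable_funeneg mf) f0).
by apply: eq_integral => w _; rewrite -/((f \o affine_flip a s)^\- w)%E funeneg_comp.
Qed.

(** Flip invariance equates the integral with its own opposite. *)
Lemma Rintegral_odd N a s (f : N.-tuple RR -> R) :
  (lebesgue_tuple R N).-integrable setT (EFin \o f) ->
  (forall w, f (affine_flip a s w) = - f w) ->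
  \int[lebesgue_tuple R N]_w f w = 0.
Proof.
move=> fi fo.
have h : \int[lebesgue_tuple R N]_w f w = - \int[lebesgue_tuple R N]_w f w.
  rewrite {1}/Rintegral -(integral_affine_flip a s (f := EFin \o f)); last first.
    by case/integrableP : fi.
  rewrite (_ : (fun w => _) = (fun w => (-1 * f w)%:E)); last first.
    by apply/funext => w /=; rewrite fo mulN1r.
  by rewrite -/(Rintegral _ _ _) RintegralZl// mulN1r.
by lra.
Qed.

Definition tuple_gauss N (c : R) (a : 'I_N -> R) (w : N.-tuple RR) : R :=
  \prod_i expR (- c * (tnth w i - a i) ^+ 2).

Lemma measurable_gauss1 (c a : R) :
  measurable_fun [set: RR] (fun x : RR => expR (- c * (x - a) ^+ 2)).
Proof.
apply: measurableT_comp => //; apply: measurable_funM => //.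
by apply: measurable_funX; apply: measurable_funB.
Qed.

Lemma measurable_tuple_gauss N c a :
  measurable_fun [set: _] (@tuple_gauss N c a).
Proof.
apply: (@measurable_fun_ptuple _ _ (fun i (x : RR) => expR (- c * (x - a i) ^+ 2))).
by move=> i; exact: measurable_gauss1.
Qed.

Lemma tuple_gauss_ge0 N c a w : 0 <= @tuple_gauss N c a w.
Proof. by apply: prodr_ge0 => i _; exact: expR_ge0. Qed.

Lemma tuple_gaussE N c a w :
  @tuple_gauss N c a w = expR (- c * \sum_i (tnth w i - a i) ^+ 2).
Proof. by rewrite mulr_sumr expR_sum. Qed.

Lemma integral_tuple_gauss N (c : R) a : 0 < c ->
  (\int[lebesgue_tuple R N]_w (@tuple_gauss N c a w)%:E =
   (Num.sqrt (pi / c) ^+ N)%:E)%E.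
Proof.
move=> c0; rewrite (@integral_tuple_prod _ _
  (fun i (x : RR) => expR (- c * (x - a i) ^+ 2)) (fun=> Num.sqrt (pi / c))).
- by rewrite prodr_const card_ord.
- by move=> i; exact: measurable_gauss1.
- by move=> i x; exact: expR_ge0.
- by move=> i; exact: integral_gaussian.
Qed.

Lemma integrable_tuple_gauss N (c : R) a : 0 < c ->
  (lebesgue_tuple R N).-integrable setT (EFin \o @tuple_gauss N c a).
Proof.
move=> c0; apply/integrableP; split.
  by apply/measurable_EFinP; exact: measurable_tuple_gauss.
under eq_integral => w _ do rewrite /= ger0_norm ?tuple_gauss_ge0//.
by rewrite integral_tuple_gauss// ltry.
Qed.

(** The exponent [- s / 2] is split in halves. One absorbs the affine factor, since
    [K1 + K2 s <= (K1 + 4 K2) (1 + s / 4)] and [1 + s / 4 <= exp (s / 4)]; the other is dominated by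
    a Gaussian in [w] because [s] is coercive. *)
Lemma integrable_gauss_bound N (g s : N.-tuple RR -> R) (k K1 K2 : R) a :
  measurable_fun [set: _] g -> 0 < k -> 0 <= K1 -> 0 <= K2 ->
  (forall w, k * \sum_i (tnth w i - a i) ^+ 2 <= s w) ->
  (forall w, `|g w| <= (K1 + K2 * s w) * expR (- 2^-1 * s w)) ->
  (lebesgue_tuple R N).-integrable setT (EFin \o g).
Proof.
move=> mg k0 K10 K20 ks gs.
apply: (@le_integrable _ _ _ _ _ _ _
  (fun w => ((K1 + 4 * K2)%:E * (tuple_gauss (k / 4) a w)%:E)%E)) => //.
- exact/measurable_EFinP.
- move=> w _; rewrite -EFinM /= lee_fin.
  have K0 : 0 <= K1 + 4 * K2 by rewrite addr_ge0// mulr_ge0.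
  rewrite [leRHS]ger0_norm ?mulr_ge0 ?tuple_gauss_ge0//.
  apply: le_trans (gs w) _.
  have sw : 0 <= s w.
    apply: le_trans (ks w); apply: mulr_ge0; first exact: ltW.
    by apply: sumr_ge0 => i _; exact: sqr_ge0.
  have e1 : 1 + s w / 4 <= expR (s w / 4) by exact: expR_ge1Dx.
  have e2 : K1 + K2 * s w <= (K1 + 4 * K2) * expR (s w / 4).
    apply: le_trans (ler_wpM2l K0 e1); rewrite -subr_ge0.
    rewrite [leRHS](_ : _ = 4 * K2 + K1 * (s w / 4)); last by field.
    by rewrite addr_ge0// mulr_ge0// divr_ge0.
  apply: le_trans (ler_wpM2r (expR_ge0 _) e2) _.
  rewrite -mulrA -expRD ler_wpM2l// tuple_gaussE ler_expR.
  have := ks w; lra.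
- apply: integrableZl => //; apply: integrable_tuple_gauss.
  by rewrite divr_gt0.
Qed.

(** A zero integral would make [g] vanish almost everywhere, hence the whole space negligible. A
    Gaussian, whose integral is known and positive, excludes this. *)
Lemma Rintegral_gt0 N (g : N.-tuple RR -> R) :
  (lebesgue_tuple R N).-integrable setT (EFin \o g) -> (forall w, 0 < g w) ->
  0 < \int[lebesgue_tuple R N]_w g w.
Proof.
move=> ig g0; rewrite lt_neqAle Rintegral_ge0 ?andbT; last by move=> w _; exact: ltW.
apply/eqP => Ig0.
have mg : measurable_fun setT (EFin \o g) by case/integrableP : ig.
have : (\int[lebesgue_tuple R N]_w `|(EFin \o g) w| = 0)%E.
  transitivity (\int[lebesgue_tuple R N]_w (g w)%:E)%E.
    by apply: eq_integral => w _ /=; rewrite ger0_norm// ltW.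
  have := integrable_fin_num measurableT ig.
  by move=> /fineK <-; rewrite -/(Rintegral _ _ _) -Ig0.
move=> /ae_eq_integral_abs => /(_ measurableT mg) h.
have mt := @measurable_tuple_gauss N 1 (fun=> 0).
have : ae_eq (lebesgue_tuple R N) setT (EFin \o tuple_gauss 1 (fun _ : 'I_N => 0)) (cst 0%E).
  apply: filterS h => w /= /(_ I) [gw0].
  by have := g0 w; rewrite gw0 ltxx.
have /measurable_EFinP mte := mt.
move=> /(ae_eq_integral_abs _ measurableT mte).
under eq_integral => w _ do rewrite /= ger0_norm ?tuple_gauss_ge0//.
rewrite integral_tuple_gauss// => -[] /eqP.
by rewrite gt_eqF// exprn_gt0// sqrtr_gt0 divr_gt0// pi_gt0.
Qed.

End tuple_integrable.

(** * Gaussian means on affine subspaces *)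

Section restricted_mean.
Context {R : realType} {N : nat}.
Local Notation RR := (measurableTypeR R).
Variable A : 'M[R]_N.
Hypothesis A_sym : A^T = A.
Hypothesis A_ge1 : forall z : 'cV[R]_N, sqnorm z <= (z^T *m A *m z) 0 0.

Lemma gauss_weight_gt0 (z : 'cV[R]_N) : 0 < gauss_weight A z.
Proof. exact: expR_gt0. Qed.

Lemma measurable_gauss_weight d (z : d.-tuple RR -> 'cV[R]_N) :
  (forall i, measurable_fun setT (fun w => z w i 0)) ->
  measurable_fun setT (fun w => gauss_weight A (z w)).
Proof.
move=> mz; apply: measurableT_comp => //; apply: measurable_funM => //.
under eq_fun do rewrite mxE.
apply: measurable_sum => j; apply: measurable_funM => //.
under eq_fun do rewrite mxE.
apply: measurable_sum => i; apply: measurable_funM => //.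
by under eq_fun do rewrite mxE; exact: mz.
Qed.

Lemma measurable_mulmx_cvec M d (B : 'M[R]_(M, d)) i :
  measurable_fun setT (fun w : d.-tuple RR => (B *m cvec w) i 0).
Proof.
under eq_fun do rewrite mxE.
apply: measurable_sum => j; apply: measurable_funM => //.
by under eq_fun do rewrite mxE; exact: measurable_tnth.
Qed.

Lemma measurable_affine_cvec M d (c : 'cV[R]_M) (B : 'M[R]_(M, d)) i :
  measurable_fun setT (fun w : d.-tuple RR => (c + B *m cvec w) i 0).
Proof.
under eq_fun do rewrite mxE.
by apply: measurable_funD => //; exact: measurable_mulmx_cvec.
Qed.

(** A left inverse of [B] bounds [u] by [B u] with the Frobenius constant [K]; [1 + K] replaces [K]
    so that the quotient makes sense when [K = 0]. *)
Lemma full_rank_coercive d (B : 'M[R]_(N, d)) : \rank B = d ->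
  exists2 k : R, 0 < k & forall u : 'cV_d, k * sqnorm u <= sqnorm (B *m u).
Proof.
move=> rB; have fB : row_free B^T by rewrite /row_free mxrank_tr rB.
have /row_freeP[B' BB'] := fB.
have invB : B'^T *m B = 1%:M.
  by rewrite -[B in _ *m B]trmxK -trmx_mul BB' trmx1.
pose K := \sum_i \sum_j (B'^T) i j ^+ 2.
have K0 : 0 <= K by do 2 (apply: sumr_ge0 => ? _); exact: sqr_ge0.
exists (1 + K)^-1; first by rewrite invr_gt0 ltr_wpDr.
move=> u; rewrite ler_pdivrMl ?ltr_wpDr//.
rewrite -{1}[u]mul1mx -invB -mulmxA.
apply: le_trans (sqnorm_mulmx_le _ _) _; apply: ler_wpM2r; first exact: sqnorm_ge0.
by rewrite lerDr.
Qed.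

Variable S : set 'cV[R]_N.
Variable F : 'cV[R]_N -> 'cV[R]_N.
Variable E : 'M[R]_N.
Hypothesis FE : forall z, F z = E *m z.
Variable zs : 'cV[R]_N.
Hypothesis S_zs : S zs.
Hypothesis S_orth : forall z, S z -> (zs^T *m A *m (z - zs)) 0 0 = 0.

(** Pythagoras for the form [A]: both cross terms vanish. On [S] the weight is thus, up to a
    constant factor, an even function of [z - zs]. *)
Let weight_split z : S z ->
  gauss_weight A z = gauss_weight A zs * gauss_weight A (z - zs).
Proof.
move=> Sz; rewrite /gauss_weight -expRD; congr expR.
set h := z - zs; have -> : z = zs + h by rewrite /h addrC subrK.
have o1 : (zs^T *m A *m h) 0 0 = 0 by exact: S_orth.
have o2 : (h^T *m A *m zs) 0 0 = 0.
  rewrite -o1 -[in RHS](trmxK (zs^T *m A *m h)) [RHS]mxE.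
  by rewrite !trmx_mul trmxK A_sym mulmxA.
have -> : (zs + h)^T = zs^T + h^T by rewrite linearD.
clearbody h; have addE (a b : 'M[R]_1) : (a + b) 0 0 = a 0 0 + b 0 0 by rewrite mxE.
by rewrite mulmxDl mulmxDl !mulmxDr !addE o1 o2; ring.
Qed.

Lemma restricted_mean_unique y : is_restricted_mean A S F y -> y = E *m zs.
Proof.
move=> [d [c [B [rB SB yE]]]].
pose z (w : d.-tuple RR) := c + B *m cvec w.
have SzT w : S (z w) by rewrite SB; exists w.
have [ws _ zws] : range z zs by rewrite -SB.
have zE w : z w - zs = B *m (cvec w - cvec ws).
  by rewrite -zws /z mulmxBr opprD addrACA subrr add0r.
(* The parametrization is affine and sends [ws] to [zs], so reflecting parameters through [ws]
   reflects [S] through [zs]. *)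
pose phi := @affine_flip R d (fun i => 2 * tnth ws i) (fun=> true).
have phiE w : z (phi w) - zs = - (z w - zs).
  rewrite !zE -mulmxN; congr (_ *m _); apply/colP => i.
  by rewrite !mxE tnth_mktuple; lra.
have gwN h : gauss_weight A (- h) = gauss_weight A h.
  rewrite /gauss_weight; have -> : (- h)^T = - h^T by rewrite linearN.
  by rewrite mulNmx mulNmx mulmxN opprK.
have [k k0 kB] := full_rank_coercive rB.
pose s (w : d.-tuple RR) := sqnorm (z w - zs).
have ks w : k * \sum_i (tnth w i - tnth ws i) ^+ 2 <= s w.
  rewrite /s zE; apply: le_trans (kB _); apply: ler_wpM2l; first exact: ltW.
  by apply: ler_sum => i _; rewrite !mxE.
have Ws w : gauss_weight A (z w) <= expR (- 2^-1 * s w).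
  rewrite weight_split//; apply: (@le_trans _ _ (1 * gauss_weight A (z w - zs))).
    rewrite ler_wpM2r ?expR_ge0// -expR0 ler_expR.
    have := le_trans (sqnorm_ge0 _) (A_ge1 zs); lra.
  by rewrite mul1r ler_expR; have := A_ge1 (z w - zs); rewrite -/(s w); lra.
have s0 w : 0 <= s w by exact: sqnorm_ge0.
have mW : measurable_fun setT (fun w => gauss_weight A (z w)).
  by apply: measurable_gauss_weight => i; exact: measurable_affine_cvec.
have iW : (lebesgue_tuple R d).-integrable setT
    (EFin \o (fun w => gauss_weight A (z w))).
  apply: (integrable_gauss_bound (K1 := 1) (K2 := 0) mW k0 _ _ ks) => // w.
  by rewrite mul0r addr0 mul1r ger0_norm ?expR_ge0.
have Wflip w : gauss_weight A (z (phi w)) = gauss_weight A (z w).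
  by rewrite weight_split// [RHS]weight_split// phiE gwN.
apply/colP => i; rewrite yE -/z.
(* [F z] is the constant [E zs] plus this term, which is odd under the reflection and integrates to
   0 against the even weight. *)
pose L w := (E *m (z w - zs)) i 0.
have Lflip w : L (phi w) = - L w by rewrite /L phiE mulmxN mxE.
have mL : measurable_fun setT L.
  rewrite (_ : L = fun w => (- (E *m zs) + E *m c + (E *m B) *m cvec w) i 0).
    exact: measurable_affine_cvec.
  apply/funext => w; rewrite /L /z; congr (_ i 0).
  by rewrite mulmxBr mulmxDr mulmxA addrC addrA.
have mLW : measurable_fun setT (fun w => L w * gauss_weight A (z w)).
  exact: measurable_funM.
pose K := \sum_j E i j ^+ 2.
have K0 : 0 <= K by apply: sumr_ge0 => j _; exact: sqr_ge0.
have iLW : (lebesgue_tuple R d).-integrable setT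
    (EFin \o (fun w => L w * gauss_weight A (z w))).
  apply: (integrable_gauss_bound (K1 := 1) (K2 := K) mLW k0 _ _ ks) => // w.
  rewrite normrM [X in _ * X]ger0_norm ?expR_ge0//.
  apply: ler_pM => //; first exact: expR_ge0.
  have : L w ^+ 2 <= K * s w by exact: sqr_mulmx_le.
  (* Trades the linear growth of [L] for a bound affine in [s], as [integrable_gauss_bound]
     requires. *)
  have : 2 * `|L w| <= 1 + L w ^+ 2.
    rewrite -[L w ^+ 2]real_normK ?num_real//.
    by have := sqr_ge0 (`|L w| - 1); rewrite sqrrB; lra.
  have := normr_ge0 (L w); lra.
have LW0 : \int[lebesgue_tuple R d]_w (L w * gauss_weight A (z w)) = 0.
  apply: (Rintegral_odd (a := fun i => 2 * tnth ws i) (s := fun=> true)) => //.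
  by move=> w; rewrite -/phi Lflip Wflip mulNr.
have RW : 0 < \int[lebesgue_tuple R d]_w gauss_weight A (z w).
  by apply: Rintegral_gt0 => // w; exact: gauss_weight_gt0.
rewrite (_ : \int[lebesgue_tuple R d]_w (F (z w) i 0 * gauss_weight A (z w)) =
  (E *m zs) i 0 * \int[lebesgue_tuple R d]_w gauss_weight A (z w)).
  by rewrite mulfK// gt_eqF.
transitivity (\int[lebesgue_tuple R d]_w ((E *m zs) i 0 * gauss_weight A (z w)
    + L w * gauss_weight A (z w))).
  apply: eq_Rintegral => w _ /=; rewrite -mulrDl FE /L mulmxBr; congr (_ * _).
  by rewrite -[in LHS](subrK (E *m zs) (E *m z w)) [in LHS]mxE addrC.
rewrite RintegralD//; last first.
  exact: (@integrableZl _ _ _ _ _ measurableT ((E *m zs) i 0) _ iW).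
by rewrite LW0 addr0 RintegralZl.
Qed.

(** [restricted_mean] is a choice with default value 0, so its value is known only once existence
    and uniqueness both hold. *)
Lemma restricted_meanE : (exists y, is_restricted_mean A S F y) ->
  restricted_mean A S F = E *m zs.
Proof.
move=> [y yP]; apply: xget_unique; last exact: restricted_mean_unique.
by rewrite -(restricted_mean_unique yP).
Qed.

End restricted_mean.

Section linear_constraint.
Context {R : realType} {N k : nat}.
Local Notation RR := (measurableTypeR R).
Variables (C : 'M[R]_(N, k)) (v0 : 'cV[R]_k).

Lemma cvec_surj d (u : 'cV[R]_d) : exists w : d.-tuple RR, cvec w = u.
Proof.
exists [tuple (u i 0 : RR) | i < d].
by apply/colP => i; rewrite mxE tnth_mktuple.
Qed.

(** The columns of [B] are a basis of the kernel of [C^T], read off from a row basis of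
    [kermx C]. *)
Lemma linear_constraint_range zs : C^T *m zs = v0 ->
  exists (d : nat) (B : 'M[R]_(N, d)), \rank B = d /\
  [set z | C^T *m z = v0] = range (fun w : d.-tuple RR => zs + B *m cvec w).
Proof.
move=> Czs; pose B0 := row_base (kermx C).
exists (\rank (kermx C)), B0^T; split.
  by rewrite mxrank_tr; apply/eqP; exact: row_base_free.
have CB : C^T *m B0^T = 0.
  rewrite -trmx_mul; apply/eqP; rewrite -(trmx0 R) (inj_eq trmx_inj).
  by rewrite -sub_kermx eq_row_base.
apply/seteqP; split => [z /= Cz|_ [w _ <-] /=]; last first.
  by rewrite mulmxDr Czs mulmxA CB mul0mx addr0.
have : ((z - zs)^T <= kermx C)%MS.
  by rewrite sub_kermx -[C]trmxK -trmx_mul mulmxBr Cz Czs subrr trmx0.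
rewrite -(eq_row_base (kermx C)) => /submxP[u uE].
have [w wE] := cvec_surj u^T.
exists w => //; rewrite wE -trmx_mul -uE trmxK addrC subrK //.
Qed.

Lemma exists_restricted_mean (A : 'M[R]_N) (F : 'cV[R]_N -> 'cV[R]_N) zs :
  C^T *m zs = v0 ->
  exists y, is_restricted_mean A [set z | C^T *m z = v0] F y.
Proof.
move=> /linear_constraint_range[d [B [rB SE]]].
pose z (w : d.-tuple RR) := zs + B *m cvec w.
exists (\col_i ((\int[lebesgue_tuple R d]_w (F (z w) i 0 * gauss_weight A (z w)))
  / (\int[lebesgue_tuple R d]_w gauss_weight A (z w)))).
by exists d, zs, B; split => // i; rewrite mxE.
Qed.

End linear_constraint.

(** * Quadratic forms under a diagonal Gaussian *)

Section gaussian_quadratic.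
Context {R : realType} {N : nat}.
Local Notation RR := (measurableTypeR R).
Variable a : 'rV[R]_N.
Hypothesis a_ge1 : forall i, 1 <= a 0 i.
Let A := diag_mx a.
Let a_gt0 i : 0 < a 0 i. Proof. exact: lt_le_trans (a_ge1 i). Qed.

Lemma quad_diag (z : 'cV[R]_N) :
  (z^T *m diag_mx a *m z) 0 0 = \sum_i a 0 i * z i 0 ^+ 2.
Proof.
rewrite mxE; apply: eq_bigr => i _; rewrite mul_mx_diag !mxE.
by ring.
Qed.

Let W (w : N.-tuple RR) : R := gauss_weight A (cvec w).

Lemma gauss_weight_diag w :
  W w = \prod_i expR (- (a 0 i / 2) * (tnth w i - 0) ^+ 2).
Proof.
rewrite /W /gauss_weight quad_diag mulr_sumr expR_sum.
by apply: eq_bigr => i _; congr expR; rewrite !mxE subr0; field.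
Qed.

Let Z : R := \prod_i Num.sqrt (pi / (a 0 i / 2)).

Let Z_gt0 : 0 < Z.
Proof. by apply: prodr_gt0 => i _; rewrite sqrtr_gt0 !divr_gt0// pi_gt0. Qed.

Lemma integral_gauss_weight_diag :
  (\int[lebesgue_tuple R N]_w (W w)%:E = Z%:E)%E.
Proof.
under eq_integral => w _ do rewrite gauss_weight_diag.
apply: (integral_tuple_prod
  (g := fun i (x : RR) => expR (- (a 0 i / 2) * (x - 0) ^+ 2))).
- by move=> i; exact: measurable_gauss1.
- by move=> i x; exact: expR_ge0.
- by move=> i; apply: integral_gaussian; rewrite divr_gt0.
Qed.

Let measurable_W : measurable_fun setT W.
Proof.
apply: measurable_gauss_weight => i.
by under eq_fun do rewrite mxE; exact: measurable_tnth.
Qed.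

Let W_ge0 w : 0 <= W w. Proof. exact: expR_ge0. Qed.

Let s (w : N.-tuple RR) := \sum_i a 0 i * tnth w i ^+ 2.

Let WE w : W w = expR (- 2^-1 * s w).
Proof.
rewrite /W /gauss_weight quad_diag; congr (expR (_ * _)).
by apply: eq_bigr => i _; rewrite mxE.
Qed.

Let sge w : 1 * \sum_i (tnth w i - 0) ^+ 2 <= s w.
Proof.
rewrite mul1r; apply: ler_sum => i _; rewrite subr0.
by rewrite ler_peMl ?sqr_ge0.
Qed.

(** [|x y|] is at most the mean of the two squares, each of which is at most the sum of all squares,
    hence at most [s]. *)
Lemma integrable_gauss_moment i j : (lebesgue_tuple R N).-integrable setT
  (EFin \o (fun w => tnth w i * tnth w j * W w)).
Proof.
apply: (integrable_gauss_bound (k := 1) (K1 := 0) (K2 := 1) _ _ _ _ sge) => //.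
  apply: measurable_funM => //; apply: measurable_funM; exact: measurable_tnth.
move=> w; rewrite add0r mul1r -WE normrM (ger0_norm (W_ge0 w)).
rewrite ler_wpM2r// normrM; apply: le_trans (sge w).
rewrite mul1r; under eq_bigr do rewrite subr0.
have h l : `|tnth w l| ^+ 2 <= \sum_i tnth w i ^+ 2.
  rewrite real_normK ?num_real// (bigD1 l)//= lerDl.
  by apply: sumr_ge0 => ? _; exact: sqr_ge0.
have := h i; have := h j.
have := sqr_ge0 (`|tnth w i| - `|tnth w j|); rewrite sqrrB; lra.
Qed.

(** Changing the sign of coordinate [i] alone keeps the diagonal weight and reverses the
    integrand. *)
Lemma gauss_moment_offdiag i j : i != j ->
  (\int[lebesgue_tuple R N]_w (tnth w i * tnth w j * W w)%:E = 0)%E.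
Proof.
move=> ij.
have := @Rintegral_odd R N (fun=> 0) (pred1 i) _ (integrable_gauss_moment i j).
rewrite /Rintegral => H.
rewrite -(fineK (integrable_fin_num measurableT (integrable_gauss_moment i j))).
rewrite H// => w; have -> : W (affine_flip (fun=> 0) (pred1 i) w) = W w.
  rewrite !WE; congr (expR (_ * _)); apply: eq_bigr => l _.
  by rewrite tnth_mktuple add0r exprMn sqrr_sign mul1r.
rewrite !tnth_mktuple !add0r /= eqxx eq_sym (negbTE ij) expr1 expr0.
by rewrite mulN1r mul1r !mulNr.
Qed.

(* [a_i x^2 / 10 <= exp (a_i x^2 / 10) - 1] trades the second moment for a
   Gaussian integral of slightly larger variance. *)
Lemma gauss_moment_diag i :
  (\int[lebesgue_tuple R N]_w (tnth w i * tnth w i * W w)%:E <=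
   (6 / 5 / a 0 i * Z)%:E)%E.
Proof.
(* [2 / 5 = 1 / 2 - 1 / 10] is the coefficient left in coordinate [i] once the weight is multiplied
   by [exp (a_i x^2 / 10)]; the mass grows by the factor [sqrt (5 / 4)]. *)
pose b l := if l == i then a 0 i * (2 / 5) else a 0 l / 2.
pose V (w : N.-tuple RR) := \prod_l expR (- b l * (tnth w l - 0) ^+ 2).
have b0 l : 0 < b l by rewrite /b; case: ifP => _; rewrite ?mulr_gt0 ?divr_gt0.
have mV : measurable_fun setT V.
  apply: (measurable_fun_ptuple (g := fun l (x : RR) => expR (- b l * (x - 0) ^+ 2))).
  by move=> l; exact: measurable_gauss1.
have V0 w : 0 <= V w by apply: prodr_ge0 => l _; exact: expR_ge0.
have IV : (\int[lebesgue_tuple R N]_w (V w)%:E = (Num.sqrt (5 / 4) * Z)%:E)%E.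
  rewrite (integral_tuple_prod
    (g := fun l (x : RR) => expR (- b l * (x - 0) ^+ 2))
    (I := fun l => Num.sqrt (pi / b l))); last 3 first.
  - by move=> l; exact: measurable_gauss1.
  - by move=> l x; exact: expR_ge0.
  - by move=> l; apply: integral_gaussian.
  congr EFin; rewrite /Z (bigD1 i)//= [in RHS](bigD1 i)//= mulrA; congr (_ * _).
    rewrite -sqrtrM; last by rewrite divr_ge0.
    congr Num.sqrt; rewrite /b eqxx; field; exact: lt0r_neq0.
  by apply: eq_bigr => l li; rewrite /b (negbTE li).
have iV : (lebesgue_tuple R N).-integrable setT (EFin \o V).
  apply/integrableP; split; first exact/measurable_EFinP.
  under eq_integral => w _ do rewrite /= ger0_norm//.
  by rewrite IV ltry.
have iW : (lebesgue_tuple R N).-integrable setT (EFin \o W).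
  apply/integrableP; split; first exact/measurable_EFinP.
  under eq_integral => w _ do rewrite /= ger0_norm//.
  by rewrite integral_gauss_weight_diag ltry.
have VW w : tnth w i * tnth w i * W w <= 10 / a 0 i * (V w - W w).
  have -> : V w = expR (a 0 i * tnth w i ^+ 2 / 10) * W w.
    rewrite /V gauss_weight_diag (bigD1 i)//= [in RHS](bigD1 i)//= [RHS]mulrA.
    congr (_ * _); last by apply: eq_bigr => l li; rewrite /b (negbTE li).
    by rewrite -expRD; congr expR; rewrite /b eqxx; field.
  rewrite -[X in _ - X]mul1r -mulrBl mulrA ler_wpM2r//.
  have := expR_ge1Dx (a 0 i * tnth w i ^+ 2 / 10).
  set e := expR _ => he.
  rewrite mulrAC ler_pdivlMr//; lra.
apply: (@le_trans _ _ (\int[lebesgue_tuple R N]_w (10 / a 0 i * (V w - W w))%:E)%E).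
  apply: ge0_le_integral => //.
  - by move=> w _; rewrite lee_fin mulr_ge0// -expr2 sqr_ge0.
  - by case/integrableP : (integrable_gauss_moment i i).
  - apply/measurable_EFinP; apply: measurable_funM => //.
    exact: measurable_funB.
  - by move=> w _; rewrite lee_fin.
under eq_integral => w _ do rewrite EFinM.
rewrite integralZl//; last exact: (integrableB measurableT iV iW).
under eq_integral => w _ do rewrite EFinB.
rewrite integralB//= IV integral_gauss_weight_diag -EFinB -EFinM lee_fin.
(* [(28 / 25)^2 = 1.2544] exceeds [5 / 4], and [10 * (28 / 25 - 1)] is the claimed [6 / 5]. *)
have q : Num.sqrt (5 / 4 : R) <= 28 / 25.
  rewrite -[leRHS]ger0_norm// -sqrtr_sqr ler_sqrt; lra.
rewrite [leLHS](_ : _ = 10 / a 0 i * Z * (Num.sqrt (5 / 4) - 1)); last by ring.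
rewrite [leRHS](_ : _ = 10 / a 0 i * Z * (3 / 25)); last by field; exact: lt0r_neq0.
rewrite ler_wpM2l//; last lra.
by rewrite mulr_ge0 ?ltW// divr_gt0.
Qed.

Variable T : 'M[R]_N.
Hypothesis T_ge0 : forall z : 'cV[R]_N, 0 <= (z^T *m T *m z) 0 0.

Let X (w : N.-tuple RR) : R := ((cvec w)^T *m T *m cvec w) 0 0.

Let XE w : X w = \sum_(p : 'I_N * 'I_N) T p.1 p.2 * (tnth w p.1 * tnth w p.2).
Proof.
rewrite /X mxE -(pair_bigA _ (fun i j => T i j * (tnth w i * tnth w j)))/= exchange_big.
apply: eq_bigr => j _; rewrite mxE mulr_suml; apply: eq_bigr => i _.
by rewrite !mxE; ring.
Qed.

Let measurable_X : measurable_fun setT X.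
Proof.
rewrite (funext XE); apply: measurable_sum => p; apply: measurable_funM => //.
by apply: measurable_funM; exact: measurable_tnth.
Qed.

Let tau := \sum_i T i i / a 0 i.

(** Off-diagonal moments vanish, which leaves a weighted trace of [T]. The diagonal moments are only
    bounded above, so the diagonal of [T] must be nonnegative; testing [T_ge0] on unit vectors shows
    it. *)
Lemma gauss_quad_mean_le :
  (\int[lebesgue_tuple R N]_w (X w * W w)%:E <= (6 / 5 * tau * Z)%:E)%E.
Proof.
have T_diag i : 0 <= T i i.
  have := T_ge0 (delta_mx i 0); rewrite trmx_delta -rowE -colE.
  by rewrite !mxE.
pose h (p : 'I_N * 'I_N) w := ((T p.1 p.2)%:E * (tnth w p.1 * tnth w p.2 * W w)%:E)%E.
have ih p : (lebesgue_tuple R N).-integrable setT (h p).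
  by apply: integrableZl => //; exact: integrable_gauss_moment.
have -> : (\int[lebesgue_tuple R N]_w (X w * W w)%:E =
    \int[lebesgue_tuple R N]_w \sum_p h p w)%E.
  apply: eq_integral => w _; rewrite XE mulr_suml -sumEFin; apply: eq_bigr => p _.
  by rewrite /h -EFinM; congr EFin; ring.
rewrite integral_sum//.
rewrite -(pair_bigA _ (fun i j => \int[lebesgue_tuple R N]_w h (i, j) w)%E)/=.
rewrite /tau mulr_sumr mulr_suml -sumEFin; apply: lee_sum => i _.
rewrite (bigD1 i)//= big1 ?adde0; last first.
  move=> j ji; rewrite /h /= integralZl//; last exact: integrable_gauss_moment.
  by rewrite gauss_moment_offdiag 1?eq_sym// mule0.
rewrite /h /= integralZl//; last exact: integrable_gauss_moment.
apply: (@le_trans _ _ ((T i i)%:E * (6 / 5 / a 0 i * Z)%:E)%E).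
  by apply: lee_wpmul2l; [rewrite lee_fin|exact: gauss_moment_diag].
by rewrite -EFinM lee_fin le_eqVlt; apply/orP; left; apply/eqP; ring.
Qed.

(* The integral of a nonnegative function is a supremum over simple functions,
   so monotonicity extends to non-measurable sets. *)
Lemma gauss_mass_mono (B G : set (N.-tuple RR)) : B `<=` G ->
  (gauss_mass A B <= gauss_mass A G)%E.
Proof.
move=> BG; rewrite /gauss_mass integral_mkcond [leRHS]integral_mkcond.
have p0 (H : set (N.-tuple RR)) w :
    (0 <= ((fun w => (gauss_weight A (cvec w))%:E) \_ H) w)%E.
  by rewrite patchE; case: ifP => // _; rewrite lee_fin expR_ge0.
rewrite !ge0_integralTE//; apply: le_ereal_sup => _ [h /= hB <-].
exists h => //= w; apply: le_trans (hB w) _.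
rewrite !patchE; case: ifPn => [|_].
  by rewrite inE => /BG; rewrite -in_setE => ->.
by case: ifP => // _; rewrite lee_fin expR_ge0.
Qed.

(** Markov's inequality for [X]. No measurability of [G] is assumed: additivity is applied to the
    sublevel set [B], and monotonicity passes from [B] to [G]. *)
Lemma gauss_prob_quad (thr : R) (G : set (N.-tuple RR)) : 0 < thr ->
  (forall w, X w <= thr -> G w) ->
  ((1 - 6 / 5 * tau / thr)%:E <= gauss_prob (diag_mx a) G)%E.
Proof.
move=> thr0 XG.
have massT : gauss_mass A setT = Z%:E by exact: integral_gauss_weight_diag.
(* The total mass [Z] is neither 0 nor infinite, so [mnormalize] divides by it instead of returning
   the Dirac mass. *)
have -> : gauss_prob (diag_mx a) G = (gauss_mass A G * Z^-1%:E)%E.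
  rewrite /gauss_prob /= /mnormalize.
  have e0 : (gauss_mass A setT == 0)%E = false by rewrite massT eqe gt_eqF.
  have e1 : (gauss_mass A setT == +oo)%E = false by rewrite massT.
  have e2 : fine (gauss_mass A setT) = Z by rewrite massT.
  by rewrite ifF /= ?e2//; apply/orP => -[]; rewrite /= ?e0 ?e1.
pose B := [set w | X w <= thr].
have mB : measurable B.
  rewrite /B (_ : [set w | _] = X @^-1` `]-oo, thr]); last first.
    by apply/seteqP; split => w /=; rewrite in_itv.
  by rewrite -[X in measurable X]setTI; apply: measurable_X.
have XW0 w : (0 <= thr^-1%:E * (X w * W w)%:E)%E.
  by rewrite -EFinM lee_fin mulr_ge0// ?invr_ge0 ?(ltW thr0)// mulr_ge0//; exact: T_ge0.
have massBC : (gauss_mass A (~` B) <= (6 / 5 * tau * Z / thr)%:E)%E.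
  apply: (@le_trans _ _ (\int[lebesgue_tuple R N]_w (thr^-1%:E * (X w * W w)%:E))%E).
    apply: (@le_trans _ _ (\int[lebesgue_tuple R N]_(w in ~` B)
        (thr^-1%:E * (X w * W w)%:E))%E).
      apply: ge0_le_integral => //.
      - exact: measurableC.
      - by move=> w _; rewrite lee_fin expR_ge0.
      - by apply: measurable_funTS; exact/measurable_EFinP.
      - apply: measurable_funTS; apply: measurable_funeM.
        by apply/measurable_EFinP; exact: measurable_funM.
      - move=> w /= /negP; rewrite -ltNge => Xw.
        rewrite -EFinM lee_fin mulrA -[leLHS]mul1r ler_wpM2r ?expR_ge0//.
        by rewrite mulrC ler_pdivlMr// mul1r ltW.
    apply: ge0_subset_integral => //.
    - exact: measurableC.
    - by apply: measurable_funeM; apply/measurable_EFinP; exact: measurable_funM.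
  rewrite ge0_integralZl//; last 3 first.
  - by apply/measurable_EFinP; exact: measurable_funM.
  - by move=> w _; rewrite lee_fin mulr_ge0//; exact: T_ge0.
  - by rewrite lee_fin invr_ge0 ltW.
  apply: le_trans (lee_wpmul2l _ gauss_quad_mean_le) _.
    by rewrite lee_fin invr_ge0 ltW.
  by rewrite -EFinM lee_fin mulrC.
have massB : (Z%:E <= gauss_mass A G + (6 / 5 * tau * Z / thr)%:E)%E.
  rewrite -massT -(setUCr B) measureU//; last 2 first.
  - exact: measurableC.
  - exact: setICr.
  by apply: leeD => //; apply: gauss_mass_mono => w; exact: XG.
apply: (@le_trans _ _ ((Z - 6 / 5 * tau * Z / thr)%:E * Z^-1%:E)%E).
  rewrite -EFinM lee_fin le_eqVlt; apply/orP; left; apply/eqP; field.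
  by rewrite !gt_eqF.
apply: lee_wpmul2r; first by rewrite lee_fin invr_ge0 ltW.
by rewrite EFinB leeBlDr.
Qed.

End gaussian_quadratic.

(** * Linear differential equations *)

Section vector_derivative.
Context {R : realType}.

Definition is_vderive N (z : R -> 'cV[R]_N) (t : R) (y : 'cV[R]_N) : Prop :=
  forall i, is_derive t (1 : R) (fun s => z s i 0) (y i 0).

Lemma is_vderive_mulmx M N (B : 'M[R]_(M, N)) z t y :
  is_vderive z t y -> is_vderive (fun s => B *m z s) t (B *m y).
Proof.
move=> zy i.
rewrite (_ : (fun s => _) = \sum_j (fun s => B i j * z s j 0)); last first.
  by apply/funext => s; rewrite mxE fct_sumE.
rewrite mxE; apply: is_derive_sum => j.
by have ? := zy j; apply: is_derive_eq.
Qed.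

Lemma is_vderiveD N (z1 z2 : R -> 'cV[R]_N) t y1 y2 :
  is_vderive z1 t y1 -> is_vderive z2 t y2 ->
  is_vderive (fun s => z1 s + z2 s) t (y1 + y2).
Proof.
move=> h1 h2 i; have ? := h1 i; have ? := h2 i.
by under eq_fun do rewrite mxE; rewrite mxE; apply: is_deriveD.
Qed.

Lemma is_vderiveZ N (z : R -> 'cV[R]_N) t y (a : R) :
  is_vderive z t y -> is_vderive (fun s => a *: z s) t (a *: y).
Proof.
move=> zy i; have ? := zy i.
by under eq_fun do rewrite mxE; rewrite mxE; apply: is_deriveZ.
Qed.

Lemma is_vderiveB N (z1 z2 : R -> 'cV[R]_N) t y1 y2 :
  is_vderive z1 t y1 -> is_vderive z2 t y2 ->
  is_vderive (fun s => z1 s - z2 s) t (y1 - y2).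
Proof.
move=> h1 h2; have := is_vderiveD h1 (is_vderiveZ (-1) h2).
rewrite scaleN1r (_ : (fun s => _) = (fun s => z1 s - z2 s))//.
by apply/funext => s; rewrite scaleN1r.
Qed.

Lemma is_derive_dot N (z1 z2 : R -> 'cV[R]_N) t y1 y2 :
  is_vderive z1 t y1 -> is_vderive z2 t y2 ->
  is_derive t (1 : R) (fun s => ((z1 s)^T *m z2 s) 0 0)
    ((y1^T *m z2 t) 0 0 + ((z1 t)^T *m y2) 0 0).
Proof.
move=> h1 h2.
rewrite (_ : (fun s => _) = \sum_j (fun s => z1 s j 0 * z2 s j 0)); last first.
  by apply/funext => s; rewrite mxE fct_sumE; apply: eq_bigr => j _; rewrite mxE.
rewrite !mxE -big_split/=; apply: is_derive_sum => j.
have ? := h1 j; have ? := h2 j; apply: is_derive_eq.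
by rewrite /= !mxE addrC [in LHS]/GRing.scale/= [y1 j 0 * _]mulrC.
Qed.

Lemma is_derive_sqnorm N (z : R -> 'cV[R]_N) t y : is_vderive z t y ->
  is_derive t (1 : R) (fun s => sqnorm (z s)) (2 * (y^T *m z t) 0 0).
Proof.
move=> zy; under eq_fun do rewrite sqnormE.
have ? := is_derive_dot zy zy; apply: is_derive_eq.
have -> : (z t)^T *m y = (y^T *m z t)^T by rewrite trmx_mul trmxK.
by rewrite [X in _ + X]mxE; ring.
Qed.

Lemma is_derive_le (f df : R -> R) (c t : R) : 0 <= t ->
  (forall s, is_derive s (1 : R) f (df s)) -> (forall s, df s <= c) ->
  f t <= f 0 + c * t.
Proof.
move=> t0 fdf dfc.
have cf : {within `[0, t], continuous f}.
  by apply: derivable_within_continuous => s _; have [] := fdf s.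
have [s _ fE] := MVT_segment t0 (fun s _ => fdf s) cf.
by rewrite -lerBlDl fE subr0 ler_wpM2r.
Qed.

End vector_derivative.

Section energy.
Context {R : realType} {N : nat}.
(* [D^T D] is the energy form; [B] preserves it infinitesimally. *)
Variables D B : 'M[R]_N.
Hypothesis D_free : forall z : 'cV[R]_N, sqnorm z <= sqnorm (D *m z).
Hypothesis DB_skew : forall z : 'cV[R]_N, ((D *m (B *m z))^T *m (D *m z)) 0 0 = 0.

Lemma dot_le M (x y : 'cV[R]_M) :
  (x^T *m y) 0 0 <= Num.sqrt (sqnorm x) * Num.sqrt (sqnorm y).
Proof.
apply: le_trans (ler_norm _) _.
rewrite -sqrtr_sqr -sqrtrM ?sqnorm_ge0// ler_wsqrtr//.
rewrite mxE; under eq_bigr do rewrite mxE.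
exact: cauchy_schwarz_sum.
Qed.

(* Gronwall without the exponential: [sqrt (|De|^2 + eps)] has slope at most [C]. *)
Lemma energy_growth (e r : R -> 'cV[R]_N) (C t : R) : 0 <= t ->
  (forall s, is_vderive e s (B *m e s + r s)) -> e 0 = 0 ->
  0 <= C -> (forall s, sqnorm (D *m r s) <= C ^+ 2) ->
  sqnorm (D *m e t) <= (C * t) ^+ 2.
Proof.
move=> t0 eB e0 C0 rC.
pose f s := sqnorm (D *m e s).
pose df s := 2 * ((D *m r s)^T *m (D *m e s)) 0 0.
have fdf s : is_derive s (1 : R) f (df s).
  have ? := is_derive_sqnorm (is_vderive_mulmx D (eB s)).
  apply: is_derive_eq; rewrite /df mulmxDr.
  have -> : (D *m (B *m e s) + D *m r s)^T =
     (D *m (B *m e s))^T + (D *m r s)^T by rewrite linearD.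
  by rewrite mulmxDl mxE DB_skew add0r.
have f0 s : 0 <= f s by exact: sqnorm_ge0.
have key eps : 0 < eps -> Num.sqrt (f t + eps ^+ 2) <= eps + C * t.
  move=> eps0; have fe s : 0 < f s + eps ^+ 2.
    by rewrite ltr_wpDl// exprn_gt0.
  pose g s := Num.sqrt (f s + eps ^+ 2).
  have gdg s : is_derive s (1 : R) g ((2 * g s)^-1 * df s).
    have ? := fdf s; have ? := is_derive1_sqrt (fe s).
    have h : is_derive s (1 : R) (fun s => f s + eps ^+ 2) (df s).
      by apply: is_derive_eq; rewrite addr0.
    exact: (@is_derive1_comp R Num.sqrt (fun s => f s + eps ^+ 2)).
  have g0E : g 0 = eps.
    by rewrite /g /f e0 mulmx0 sqnormE mulmx0 mxE add0r sqrtr_sqr gtr0_norm.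
  suff : g t <= g 0 + C * t by rewrite g0E.
  apply: (is_derive_le t0 gdg) => s.
  have g0 : 0 < g s by rewrite sqrtr_gt0.
  rewrite mulrC ler_pdivrMr ?mulr_gt0// /df [_ * (2 * _)]mulrCA ler_wpM2l//.
  (* Cauchy-Schwarz: [|D r| <= C], while [|D e| <= g] cancels the denominator of the slope. *)
  apply: le_trans (dot_le _ _) _; apply: ler_pM; rewrite ?sqrtr_ge0//.
    by rewrite -[leRHS]ger0_norm// -sqrtr_sqr ler_wsqrtr.
  by rewrite ler_wsqrtr// lerDl sqr_ge0.
have Ct0 : 0 <= C * t by rewrite mulr_ge0.
have : Num.sqrt (f t) <= C * t.
  (* Half of the supposed gap, so that [key] would give [sqrt (f t) <= eps + C t < sqrt (f t)]. *)
  rewrite leNgt; apply/negP => lt; pose eps := (Num.sqrt (f t) - C * t) / 2.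
  have eps0 : 0 < eps by rewrite divr_gt0// subr_gt0.
  have := key _ eps0; apply/negP; rewrite -ltNge.
  apply: (@lt_le_trans _ _ (Num.sqrt (f t))); first by rewrite /eps; lra.
  by rewrite ler_wsqrtr// lerDl sqr_ge0.
move=> h; rewrite -[leLHS]sqr_sqrtr ?sqnorm_ge0//.
by rewrite ler_pXn2r// nnegrE ?sqrtr_ge0.
Qed.

Lemma linear_ode_zero (e : R -> 'cV[R]_N) t : 0 <= t ->
  (forall s, is_vderive e s (B *m e s)) -> e 0 = 0 -> e t = 0.
Proof.
move=> t0 eB e0; apply: sqnorm_eq0; apply/eqP; rewrite eq_le sqnorm_ge0 andbT.
apply: le_trans (D_free _) _.
rewrite -[leRHS](_ : (0 * t) ^+ 2 = 0); last by rewrite mul0r expr0n.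
apply: (@energy_growth _ (fun=> 0)) => //.
- by move=> s; rewrite addr0.
- by move=> s; rewrite mulmx0 sqnormE mulmx0 mxE expr0n.
Qed.

(** [E] stands for [exp (t B)]. The defect of linearity of [Phi] solves the same equation from 0,
    hence vanishes by [linear_ode_zero]; the columns of [E] are then the images of the unit
    vectors. *)
Lemma linear_ode_flow (Phi : 'cV[R]_N -> R -> 'cV[R]_N) t : 0 <= t ->
  (forall z, Phi z 0 = z /\ forall s, is_vderive (Phi z) s (B *m Phi z s)) ->
  exists E : 'M[R]_N, forall z, Phi z t = E *m z.
Proof.
move=> t0 PhiP.
have PhiL a x y : Phi (a *: x + y) t = a *: Phi x t + Phi y t.
  have [x0 xB] := PhiP x; have [y0 yB] := PhiP y.
  have [z0 zB] := PhiP (a *: x + y).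
  apply/eqP; rewrite -subr_eq0; apply/eqP.
  apply: (@linear_ode_zero (fun s => Phi (a *: x + y) s - (a *: Phi x s + Phi y s))) => //.
    move=> s; rewrite mulmxBr mulmxDr -scalemxAr.
    apply: is_vderiveB => //; apply: is_vderiveD => //; exact: is_vderiveZ.
  by rewrite x0 y0 z0 subrr.
have Phi_sum (I : seq 'I_N) (c : 'I_N -> R) (x : 'I_N -> 'cV[R]_N) :
    Phi (\sum_(i <- I) c i *: x i) t = \sum_(i <- I) c i *: Phi (x i) t.
  elim: I => [|i I IH]; last by rewrite !big_cons PhiL IH.
  rewrite !big_nil; have := PhiL (-1) 0 0.
  by rewrite !scaleN1r oppr0 addr0 addNr.
exists (\matrix_(i, j) Phi (delta_mx j 0) t i 0) => z.
have zE : z = \sum_j z j 0 *: delta_mx j 0.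
  rewrite [LHS]matrix_sum_delta; apply: eq_bigr => i _.
  by rewrite big_ord_recl big_ord0 addr0.
rewrite [in LHS]zE Phi_sum; apply/colP => i.
by rewrite summxE mxE; apply: eq_bigr => j _; rewrite !mxE mulrC.
Qed.

End energy.

(* [S W v] is a Hamiltonian vector field for the quadratic Hamiltonian [v^T W v / 2]. *)
Lemma hamiltonian_conserved {R : realType} {N : nat} (S W : 'M[R]_N)
    (v : R -> 'cV[R]_N) (t : R) :
  W^T = W -> S^T = - S -> (forall s, is_vderive v s (S *m W *m v s)) ->
  ((v t)^T *m W *m v t) 0 0 = ((v 0)^T *m W *m v 0) 0 0.
Proof.
move=> Wsym Sskew vS.
pose H s := ((v s)^T *m (W *m v s)) 0 0.
suff Hcst : H t = H 0 by move: Hcst; rewrite /H !mulmxA.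
apply: is_derive_0_is_cst => s.
have ? := is_derive_dot (vS s) (is_vderive_mulmx W (vS s)).
apply: is_derive_eq.
set w := W *m v s.
have e1 : S *m W *m v s = S *m w by rewrite /w mulmxA.
have e2 : (v s)^T *m (W *m (S *m w)) = w^T *m (S *m w).
  by rewrite /w trmx_mul Wsym !mulmxA.
rewrite !e1 e2.
have -> : (S *m w)^T *m w = - (w^T *m (S *m w)).
  by rewrite trmx_mul Sskew mulmxN mulNmx mulmxA.
by rewrite mxE addNr.
Qed.

(** * Trigonometric polynomials *)

Section trigonometric_basis.
Context {R : realType}.

Lemma wavenumber_le m (i : 'I_(2 * m).+1) : (wavenumber i <= m)%N.
Proof.
rewrite /wavenumber; case: ifP => _; first exact: leq_subr.
by rewrite leq_subLR addnn -mul2n -ltnS.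
Qed.

Lemma wavenumber_eq0 m (i : 'I_(2 * m).+1) :
  (wavenumber i == 0%N) = (i == m :> nat).
Proof. by rewrite /wavenumber; case: ifPn; lia. Qed.

Definition trig_amp m (i : 'I_(2 * m).+1) : R :=
  if i == m :> nat then (Num.sqrt (2 * pi))^-1 else (Num.sqrt pi)^-1.

Definition trig_phase m (i : 'I_(2 * m).+1) : R :=
  if (i <= m)%N then 0 else pi / 2.

(** Amplitude and phase put constant, cosine and sine modes in one formula, so that a single
    product-to-sum identity serves all pairs. *)
Lemma trig_basisE m (i : 'I_(2 * m).+1) (x : R) :
  trig_basis i x = trig_amp i * cos ((wavenumber i)%:R * x - trig_phase i).
Proof.
rewrite /trig_basis /trig_amp /trig_phase.
case: (ltngtP i m) => im.
- by rewrite subr0 mulrC.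
- by rewrite cosB cos_pihalf sin_pihalf mulr0 add0r mulr1 mulrC.
- by rewrite /wavenumber im leqnn subnn mul0r subr0 cos0 mulr1.
Qed.

Lemma trig_amp_sqr m (i : 'I_(2 * m).+1) :
  trig_amp i ^+ 2 = (if i == m :> nat then 2 * pi else pi)^-1.
Proof.
rewrite /trig_amp; case: ifP => _; rewrite exprVn sqr_sqrtr//; first by rewrite mulr_ge0// pi_ge0.
exact: pi_ge0.
Qed.

(* [J] is integration over a period or summation over an equispaced grid. *)
Lemma trig_basis_ortho m (J : (R -> R) -> R) (V : R) :
  (forall (c p1 p2 : R) (k1 k2 : nat), (k1 <= 2 * m)%N -> (k2 <= 2 * m)%N ->
    J (fun x => c * cos (k1%:R * x - p1) + c * cos (k2%:R * x - p2)) =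
    V * (c * (k1 == 0%N)%:R * cos p1 + c * (k2 == 0%N)%:R * cos p2)) ->
  forall i j : 'I_(2 * m).+1,
    J (fun x => trig_basis i x * trig_basis j x) = V / (2 * pi) * (i == j)%:R.
Proof.
move=> HJ i j; wlog ij : i j / (wavenumber j <= wavenumber i)%N => [WH|].
  case/orP: (leq_total (wavenumber j) (wavenumber i)) => [/WH//|/WH H].
  by rewrite eq_sym -H; congr J; apply/funext => x; rewrite mulrC.
have pi0 : (pi : R) != 0 by rewrite gt_eqF// pi_gt0.
have wi := wavenumber_le i; have wj := wavenumber_le j.
pose c : R := trig_amp i * trig_amp j / 2.
have -> : (fun x => trig_basis i x * trig_basis j x) =
  (fun x => c * cos ((wavenumber i + wavenumber j)%:R * x - (trig_phase i + trig_phase j))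
    + c * cos ((wavenumber i - wavenumber j)%:R * x - (trig_phase i - trig_phase j))).
  apply/funext => x; rewrite !trig_basisE natrD natrB//.
  set a := _ * x - trig_phase i; set b := _ * x - trig_phase j.
  have -> : ((wavenumber i)%:R + (wavenumber j)%:R) * x -
    (trig_phase i + trig_phase j) = a + b by rewrite /a /b; ring.
  have -> : ((wavenumber i)%:R - (wavenumber j)%:R) * x -
    (trig_phase i - trig_phase j) = a - b by rewrite /a /b; ring.
  by rewrite (cosD a b) (cosB a b) /c; field.
(* Sums of two wavenumbers stay within [2 * m], below the first alias of 0 on a grid of [2 * m + 1]
   points. *)
rewrite HJ; [|lia|lia].
rewrite addn_eq0 subn_eq0.
have [eij|neq] := eqVneq i j.
  subst j; rewrite leqnn andbb subrr cos0 /c -expr2 trig_amp_sqr wavenumber_eq0.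
  rewrite /trig_phase; case: ifPn => [/eqP ->|_] /=.
    by rewrite leqnn addr0 cos0; move: (pi : R) pi0 => P P0; field.
  by move: (pi : R) pi0 => P P0; field.
rewrite mulr0.
have nz : ~~ ((wavenumber i == 0%N) && (wavenumber j == 0%N)).
  rewrite !wavenumber_eq0; apply/negP => /andP[/eqP h1 /eqP h2].
  by move/eqP: neq; apply; apply: val_inj; rewrite /= h1 h2.
rewrite (negbTE nz) !mulr0 mul0r add0r.
have [le|lt] := leqP (wavenumber i) (wavenumber j); last by rewrite !(mulr0, mul0r).
have e : wavenumber i = wavenumber j by apply/eqP; rewrite eqn_leq le ij.
(* Distinct modes of equal frequency are a cosine and a sine, whose phases differ by [pi / 2]. *)
have : (i <= m)%N != (j <= m)%N.
  apply/negP => /eqP h; move: e; rewrite /wavenumber h => e.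
  move/eqP: neq; apply; apply: val_inj => /=; move: e h.
  by case: ifP; move: (ltn_ord i) (ltn_ord j); lia.
rewrite /trig_phase; case: (i <= m)%N; case: (j <= m)%N => // _.
  by rewrite add0r cosN cos_pihalf !mulr0.
by rewrite subr0 cos_pihalf !mulr0.
Qed.

Lemma sin_2pi_periodic (x : R) (k : nat) : sin (x + k%:R * (2 * pi)) = sin x.
Proof.
elim: k => [|k IH]; first by rewrite mul0r addr0.
have -> : x + k.+1%:R * (2 * pi) = (x + k%:R * (2 * pi)) + pi *+ 2.
  by rewrite -natr1 -mulr_natr; ring.
by rewrite sinD2pi.
Qed.

Lemma sum_cos_grid n (k : nat) (p : R) : (0 < k)%N -> (k <= 2 * n)%N ->
  \sum_(al < (2 * n).+1) cos (k%:R * gridpt R al - p) = 0.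
Proof.
move=> k0 kn; set N := (2 * n).+1.
have N0 : (N%:R : R) != 0 by rewrite pnatr_eq0.
pose th : R := k%:R * (2 * pi) / N%:R.
have thE (al : 'I_N) : k%:R * gridpt R al = th * al%:R.
  by rewrite /gridpt /th -/N; field.
(* [th / 2 = pi k / N] lies strictly between 0 and [pi] because [0 < k < N]. *)
have sth : sin (th / 2) != 0.
  rewrite gt_eqF// sin_gt0_pi//.
  rewrite /th [X in 0 < X < _](_ : _ = pi * (k%:R / N%:R)); last by field.
  rewrite mulr_gt0 ?pi_gt0 ?divr_gt0 ?ltr0n//=.
  by rewrite gtr_pMr ?pi_gt0// ltr_pdivrMr ?ltr0n// mul1r ltr_nat ltnS.
(* Multiplying by [2 sin (th / 2)] makes the sum telescope. *)
apply/eqP; rewrite -(mulIr_eq0 _ (mulIf sth)) -[_ == 0](mulIr_eq0 _ (@mulIf R 2 _))//.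
rewrite !mulr_suml.
pose F (j : nat) := sin (th * j%:R - p - th / 2).
rewrite (eq_bigr (fun al : 'I_N => F al.+1 - F al)); last first.
  move=> al _; rewrite thE /F -[al.+1%:R]natr1.
  have -> : th * (al%:R + 1) - p - th / 2 = (th * al%:R - p) + th / 2 by field.
  have sc u h : cos u * sin h * 2 = sin (u + h) - sin (u - h) :> R.
    by rewrite sinD sinB; ring.
  exact: sc.
rewrite -(big_mkord xpredT (fun j => F j.+1 - F j)) telescope_sumr//.
rewrite /F mulr0 [X in sin X](_ : _ = (0 - p - th / 2) + k%:R * (2 * pi)).
  by rewrite sin_2pi_periodic subrr.
by rewrite /th; field.
Qed.

Lemma trig_basis_grid_ortho n (i j : 'I_(2 * n).+1) :
  \sum_(al < (2 * n).+1) trig_basis i (gridpt R al) * trig_basis j (gridpt R al)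
  = (2 * n).+1%:R / (2 * pi) * (i == j)%:R.
Proof.
apply: (@trig_basis_ortho n (fun f => \sum_(al < (2 * n).+1) f (gridpt R al))).
move=> c p1 p2 k1 k2 hk1 hk2; rewrite big_split/= -!mulr_sumr.
have H (k : nat) p : (k <= 2 * n)%N ->
    \sum_(al < (2 * n).+1) cos (k%:R * gridpt R al - p) =
    (2 * n).+1%:R * (k == 0%N)%:R * cos p.
  case: k => [_|k hk]; last by rewrite sum_cos_grid// mulr0 mul0r.
  rewrite (eq_bigr (fun=> cos p)); last by move=> al _; rewrite mul0r add0r cosN.
  by rewrite sumr_const card_ord eqxx mulr1 mulr_natl.
by rewrite !H//; ring.
Qed.

Lemma is_derive_affine (k p x : R) : is_derive x (1 : R) (fun y => k * y - p) k.
Proof.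
have h : is_derive x (1 : R) (k \*: id - cst p) (k *: 1 - 0).
  by apply: is_deriveB.
by apply: is_derive_eq h _; rewrite subr0 [LHS]mulr1.
Qed.

Lemma is_derive_sin_affine (k p x : R) :
  is_derive x (1 : R) (fun y => sin (k * y - p)) (cos (k * x - p) * k).
Proof.
exact: (@is_derive1_comp R sin (fun y => k * y - p) x _ _
  (is_derive_sin _) (is_derive_affine k p x)).
Qed.

Lemma is_derive_cos_affine (k p x : R) :
  is_derive x (1 : R) (fun y => cos (k * y - p)) (- sin (k * x - p) * k).
Proof.
exact: (@is_derive1_comp R cos (fun y => k * y - p) x _ _
  (is_derive_cos _) (is_derive_affine k p x)).
Qed.

Lemma continuous_cos_affine (k c p : R) :
  continuous (fun x : R => c * cos (k * x - p)).
Proof.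
move=> x; apply: (@continuousM _ _ (cst c)); first exact: cvg_cst.
apply: continuous_comp; last exact: continuous_cos.
apply: continuousB; last exact: cvg_cst.
by apply: continuousM; [exact: cvg_cst|exact: cvg_id].
Qed.

Lemma cos_integrable (k c p : R) :
  (@lebesgue_measure R).-integrable `[0, 2 * pi] (EFin \o (fun x => c * cos (k * x - p))).
Proof.
apply: continuous_compact_integrable; first exact: segment_compact.
by apply: continuous_subspaceT; exact: continuous_cos_affine.
Qed.

Lemma Rintegral_cos (k : nat) (c p : R) :
  \int[@lebesgue_measure R]_(x in `[0, 2 * pi]) (c * cos (k%:R * x - p)) =
  2 * pi * (c * (k == 0%N)%:R * cos p).
Proof.
have pi20 : 0 < 2 * pi :> R by rewrite mulr_gt0// pi_gt0.
case: k => [|k].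
  rewrite (@eq_Rintegral _ _ _ _ _ (fun=> c * cos p)); last first.
    by move=> x _; rewrite mul0r add0r cosN.
  rewrite Rintegral_cst//= lebesgue_measure_itv/= lte_fin pi20 /=.
  by rewrite subr0 mulr1 mulrC.
have k0 : k.+1%:R != 0 :> R by rewrite pnatr_eq0.
rewrite !(mulr0, mul0r) /Rintegral.
pose F x : R := c / k.+1%:R * sin (k.+1%:R * x - p).
have dF x : is_derive x (1 : R) F (c * cos (k.+1%:R * x - p)).
  have ? := is_derive_sin_affine k.+1%:R p x; apply: is_derive_eq.
  by rewrite /GRing.scale/=; move: (k.+1%:R) k0 => K K0; field.
have cF x : {for x, continuous F}.
  by apply/differentiable_continuous/derivable1_diffP; have [] := dF x.
rewrite (@continuous_FTC2 _ _ F)//.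
- by rewrite /= /F -[k.+1%:R * (2 * pi)]add0r addrAC sin_2pi_periodic mulr0 add0r subrr.
- by apply: continuous_subspaceT; exact: continuous_cos_affine.
- split.
  + by move=> x _; have [] := dF x.
  + by apply: cvg_at_right_filter; exact: cF.
  + by apply: cvg_at_left_filter; exact: cF.
- by move=> x _; rewrite derive1E; have [_ ->] := dF x.
Qed.

Lemma trig_basis_integrable m (i j : 'I_(2 * m).+1) :
  (@lebesgue_measure R).-integrable `[0, 2 * pi]
    (EFin \o (fun x => trig_basis i x * trig_basis j x)).
Proof.
apply: continuous_compact_integrable; first exact: segment_compact.
apply: continuous_subspaceT => x.
have cb l : {for x, continuous (@trig_basis R m l)}.
  rewrite (_ : trig_basis l = fun y => trig_amp l * cos ((wavenumber l)%:R * y - trig_phase l)).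
    exact: continuous_cos_affine.
  by apply/funext => y; rewrite trig_basisE.
by apply: continuousM; exact: cb.
Qed.

Lemma trig_basis_Rintegral_ortho m (i j : 'I_(2 * m).+1) :
  \int[@lebesgue_measure R]_(x in `[0, 2 * pi]) (trig_basis i x * trig_basis j x)
  = (i == j)%:R.
Proof.
rewrite (@trig_basis_ortho m
  (fun f => \int[@lebesgue_measure R]_(x in `[0, 2 * pi]) f x) (2 * pi)).
  by rewrite divff ?mul1r// gt_eqF// mulr_gt0// pi_gt0.
move=> c p1 p2 k1 k2 _ _; rewrite RintegralD//; [|exact: cos_integrable..].
by rewrite !Rintegral_cos -mulrDr.
Qed.

(** Discrete Fourier inversion. With grid values in place of Fourier integrals, time derivatives
    known pointwise in [x] pass to the coefficients through a finite sum. *)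
Lemma trig_coef m (q : coefs R m) i :
  q i 0 = 2 * pi / (2 * m).+1%:R *
    \sum_(al < (2 * m).+1) trig q (gridpt R al) * trig_basis i (gridpt R al).
Proof.
under eq_bigr do rewrite /trig mulr_suml.
rewrite exchange_big/= (bigD1 i)//= [X in _ + X]big1 ?addr0; last first.
  move=> j ji; under eq_bigr do rewrite -mulrA.
  by rewrite -mulr_sumr trig_basis_grid_ortho (negbTE ji) !mulr0.
under eq_bigr do rewrite -mulrA.
rewrite -mulr_sumr trig_basis_grid_ortho eqxx mulr1.
have P0 : (pi : R) != 0 by rewrite gt_eqF// pi_gt0.
have M0 : (2 * m).+1%:R != 0 :> R by rewrite pnatr_eq0.
move: P0 M0; move: (pi : R) ((2 * m).+1%:R : R) => P M P0 M0; field.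
by rewrite P0 M0.
Qed.

Lemma trig_derive1n2 m (q : coefs R m) (x : R) :
  derive1n 2 (trig q) x = - \sum_i (wavenumber i)%:R ^+ 2 * q i 0 * trig_basis i x.
Proof.
have d1 y : is_derive y (1 : R) (trig q)
    (\sum_i q i 0 * (trig_amp i * (- sin ((wavenumber i)%:R * y - trig_phase i) * (wavenumber i)%:R))).
  rewrite (_ : trig q = \sum_i (fun y => q i 0 * (trig_amp i * cos ((wavenumber i)%:R * y - trig_phase i)))).
    apply: is_derive_sum => i.
    have ? := is_derive_cos_affine (wavenumber i)%:R (trig_phase i) y.
    exact: is_deriveZ.
  apply/funext => z; rewrite /trig fct_sumE; apply: eq_bigr => i _.
  by rewrite trig_basisE.
have d2 y : is_derive y (1 : R) (fun y =>
    \sum_i q i 0 * (trig_amp i * (- sin ((wavenumber i)%:R * y - trig_phase i) * (wavenumber i)%:R)))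
    (- \sum_i (wavenumber i)%:R ^+ 2 * q i 0 * trig_basis i y).
  rewrite (_ : (fun y => _) = \sum_i (fun y => (- (q i 0 * trig_amp i * (wavenumber i)%:R))
      * sin ((wavenumber i)%:R * y - trig_phase i))); last first.
    apply/funext => z; rewrite fct_sumE; apply: eq_bigr => i _; ring.
  rewrite -sumrN; apply: is_derive_sum => i.
  have ? := is_derive_sin_affine (wavenumber i)%:R (trig_phase i) y.
  apply: is_derive_eq; rewrite trig_basisE /GRing.scale/=; ring.
rewrite /= derive1E.
rewrite (_ : derive1 (trig q) = fun y => \sum_i q i 0 * (trig_amp i * (- sin ((wavenumber i)%:R * y - trig_phase i) * (wavenumber i)%:R))).
  by have [_ ->] := d2 x.
by apply/funext => y; rewrite derive1E; have [_ ->] := d1 y.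
Qed.

End trigonometric_basis.

(** * Error of the projected evolution *)

Section optimal_prediction_error.
Context {R : realType} {N k : nat}.
Variables (D A L : 'M[R]_N) (C : 'M[R]_(N, k)).
Hypothesis AD : A = D^T *m D.
Hypothesis A_unit : A \in unitmx.
Hypothesis D_ge1 : forall z : 'cV[R]_N, sqnorm z <= sqnorm (D *m z).
Hypothesis DL_skew : forall z : 'cV[R]_N, ((D *m (L *m z))^T *m (D *m z)) 0 0 = 0.
Hypothesis C_inj : forall u : 'cV[R]_k, C *m u = 0 -> u = 0.
Let K := L *m invmx A.
Hypothesis K_skew : K^T = - K.
Let M := C^T *m invmx A *m C.

Lemma energy_form_sym : A^T = A.
Proof. by rewrite AD trmx_mul trmxK. Qed.

Lemma inv_energy_form_sym : (invmx A)^T = invmx A.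
Proof. by rewrite trmx_inv energy_form_sym. Qed.

Lemma energy_form_sqnorm (z : 'cV[R]_N) : (z^T *m A *m z) 0 0 = sqnorm (D *m z).
Proof. by rewrite sqnormE AD trmx_mul !mulmxA. Qed.

(** [M] is the Gram matrix of the columns of [A^-1 C] for the energy product; its invertibility
    follows from this and the injectivity of [C]. *)
Lemma gram_sqnorm (u : 'cV[R]_k) :
  (u^T *m M *m u) 0 0 = sqnorm (D *m (invmx A *m (C *m u))).
Proof.
rewrite -energy_form_sqnorm /M !trmx_mul inv_energy_form_sym !mulmxA.
by rewrite mulmxKV.
Qed.

Lemma gram_sym : M^T = M.
Proof. by rewrite /M !trmx_mul trmxK inv_energy_form_sym mulmxA. Qed.

Lemma gram_unit : M \in unitmx.
Proof.
rewrite -row_free_unit -kermx_eq0; apply/eqP/row_matrixP => i.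
rewrite row0; set w := row i _.
have wM : w *m M = 0 by apply/eqP; rewrite -sub_kermx row_sub.
have : sqnorm (D *m (invmx A *m (C *m w^T))) = 0.
  by rewrite -gram_sqnorm trmxK wM mul0mx mxE.
move=> h0; have : sqnorm (invmx A *m (C *m w^T)) = 0.
  by apply/eqP; rewrite eq_le sqnorm_ge0 andbT -h0 D_ge1.
move/sqnorm_eq0 => /(congr1 (mulmx A)); rewrite mulKVmx// mulmx0.
by move/C_inj => /(congr1 trmx); rewrite trmxK trmx0.
Qed.

Lemma inv_gram_sym : (invmx M)^T = invmx M.
Proof. by rewrite trmx_inv gram_sym. Qed.

(* [x - A^-1 C M^-1 C^T x] is the residual of an [A]-orthogonal projection. *)
Lemma projection_residual_le (x : 'cV[R]_N) (y : 'cV[R]_k) :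
  sqnorm (D *m (x - invmx A *m (C *m (invmx M *m (C^T *m x))))) <=
  sqnorm (D *m (x - invmx A *m (C *m y))).
Proof.
set w := invmx M *m (C^T *m x); set p := x - _.
have -> : x - invmx A *m (C *m y) = p + invmx A *m (C *m (w - y)).
  by rewrite /p !mulmxBr addrA subrK.
set d := invmx A *m _.
have cross : (p^T *m A *m d) 0 0 = 0.
  have -> : p^T *m A *m d = (C^T *m p)^T *m (w - y).
    by rewrite /d trmx_mul trmxK -!mulmxA mulKVmx.
  rewrite (_ : C^T *m p = 0) ?trmx0 ?mul0mx ?mxE//.
  by rewrite /p mulmxBr !mulmxA -/M mulmxV ?gram_unit// mul1mx subrr.
rewrite -[leRHS]energy_form_sqnorm -[leLHS]energy_form_sqnorm.
have cross' : (d^T *m A *m p) 0 0 = 0.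
  rewrite -cross -[in RHS](trmxK (p^T *m A *m d)) [RHS]mxE.
  by rewrite !trmx_mul trmxK energy_form_sym mulmxA.
clearbody p d; have addE (a b : 'M[R]_1) : (a + b) 0 0 = a 0 0 + b 0 0 by rewrite mxE.
have -> : (p + d)^T = p^T + d^T by rewrite linearD.
rewrite mulmxDl mulmxDl !mulmxDr !addE cross cross' add0r addr0 lerDl.
by rewrite energy_form_sqnorm sqnorm_ge0.
Qed.

Lemma optimal_prediction_error (kappa : R) (z : R -> 'cV[R]_N) (v : R -> 'cV[R]_k) (t : R) :
  0 <= kappa -> 0 <= t ->
  (forall u : 'cV[R]_k, exists y : 'cV[R]_k,
    sqnorm (D *m (K *m C *m u - invmx A *m (C *m y))) <=
    kappa ^+ 2 * (u^T *m M *m u) 0 0) ->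
  (forall s, is_vderive z s (L *m z s)) ->
  (forall s, is_vderive v s (C^T *m K *m C *m invmx M *m v s)) ->
  z 0 = invmx A *m C *m invmx M *m v 0 ->
  sqnorm (D *m (z t - invmx A *m C *m invmx M *m v t)) <=
  (kappa * t) ^+ 2 * ((v 0)^T *m invmx M *m v 0) 0 0.
Proof.
move=> kappa0 t0 bound zL vS z0.
pose Ba := invmx A *m C *m invmx M; pose S := C^T *m K *m C.
have S_skew : S^T = - S.
  by rewrite /S trmx_mul (trmx_mul C^T K) trmxK K_skew mulNmx mulmxN mulmxA.
have H_eq (s : R) : ((v s)^T *m invmx M *m v s) 0 0 = ((v 0)^T *m invmx M *m v 0) 0 0.
  by apply: (@hamiltonian_conserved _ _ S) => //; exact: inv_gram_sym.
set H := ((v 0)^T *m invmx M *m v 0) 0 0.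
(* With [u = M^-1 v], the conserved [v^T M^-1 v] is the [u^T M u] that appears in [bound]. *)
have gram_inv (w : 'cV[R]_k) : (w^T *m invmx M *m w) 0 0 = ((invmx M *m w)^T *m M *m (invmx M *m w)) 0 0.
  by rewrite trmx_mul inv_gram_sym mulmxKV ?gram_unit// mulmxA.
have H0 : 0 <= H by rewrite /H gram_inv gram_sqnorm sqnorm_ge0.
pose e s := z s - Ba *m v s.
pose r s := L *m (Ba *m v s) - Ba *m (S *m invmx M *m v s).
have eL s : is_vderive e s (L *m e s + r s).
  rewrite /r /e mulmxBr addrA subrK.
  by apply: is_vderiveB => //; exact: is_vderive_mulmx.
have e0 : e 0 = 0 by rewrite /e z0 subrr.
have rC s : sqnorm (D *m r s) <= (kappa * Num.sqrt H) ^+ 2.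
  rewrite exprMn sqr_sqrtr//; set u := invmx M *m v s.
  have -> : r s = K *m C *m u - invmx A *m (C *m (invmx M *m (C^T *m (K *m C *m u)))).
    by rewrite /r /Ba /K /S /u !mulmxA.
  have [y hy] := bound u; apply: le_trans (projection_residual_le _ y) _.
  by apply: le_trans hy _; rewrite /u -gram_inv H_eq.
have := energy_growth DL_skew t0 eL e0 _ rC.
rewrite mulr_ge0 ?sqrtr_ge0// => /(_ isT) h; apply: le_trans h _.
by rewrite !exprMn sqr_sqrtr// mulrAC.
Qed.

End optimal_prediction_error.

(** * Observations and aliasing *)

Section observation_kernel.
Context {R : realType}.

Definition damping m (sigma : R) (i : 'I_(2 * m).+1) : R :=
  expR (- ((wavenumber i)%:R ^+ 2 * sigma ^+ 2 / 4)).

Lemma gker_sum m (sigma x : R) : gker m sigma x = (2 * pi)^-1 *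
  \sum_(j < (2 * m).+1) expR (- ((j%:R - m%:R) ^+ 2 * sigma ^+ 2 / 4)) *
    cos ((j%:R - m%:R) * x).
Proof.
have ReM (a : R) (z : R[i]%C) : complex.Re (a%:C * z)%C = a * complex.Re z.
  by case: z => u v /=; rewrite mul0r subr0.
rewrite /gker ReM; congr (_ * _).
rewrite (big_morph (@complex.Re R) (id1 := 0) (op1 := +%R)) //; last first.
  by move=> [a b] [c d].
by apply: eq_bigr => j _; rewrite ReM.
Qed.

Lemma gkerE m (sigma x y : R) : gker m sigma (x - y) =
  \sum_(i < (2 * m).+1) damping sigma i * trig_basis i x * trig_basis i y.
Proof.
rewrite gker_sum mulr_sumr.
set a := BIG_F; set b := (X in _ = \sum_(i < _) X i).
(* Frequencies [k] and [-k] on the left match the cosine and the sine of frequency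
   [|k|] on the right. *)
suff H i : a i + a (rev_ord i) = b i + b (rev_ord i).
  have aa : \sum_i a i + \sum_i a i = \sum_i (a i + a (rev_ord i)).
    by rewrite big_split/= [X in _ + X](reindex_inj rev_ord_inj).
  have bb : \sum_i b i + \sum_i b i = \sum_i (b i + b (rev_ord i)).
    by rewrite big_split/= [X in _ + X](reindex_inj rev_ord_inj).
  have : \sum_i a i + \sum_i a i = \sum_i b i + \sum_i b i.
    by rewrite aa bb; apply: eq_bigr => i _.
  lra.
wlog im : i / (i <= m)%N => [WH|].
  case: (leqP i m) => [/WH//|mi].
  have /WH : (rev_ord i <= m)%N by rewrite /= subSS; lia.
  by rewrite rev_ordK addrC => ->; rewrite addrC.
have rE : (rev_ord i : nat) = (2 * m - i)%N by rewrite /= subSS.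
have iE : (i%:R - m%:R : R) = - (m - i)%:R by rewrite natrB// opprB.
have rE' : ((rev_ord i)%:R - m%:R : R) = (m - i)%:R.
  by rewrite rE (_ : (2 * m - i = m + (m - i))%N); [rewrite natrD; ring|lia].
have wi : wavenumber i = (m - i)%N by rewrite /wavenumber im.
have wr : wavenumber (rev_ord i) = (m - i)%N.
  by rewrite /wavenumber rE; case: ifP; lia.
rewrite /a /b /damping rE' iE wi wr sqrrN mulNr cosN mulrBr cosB.
rewrite /trig_basis wi wr rE.
set e := expR _; set k : R := (m - i)%:R.
have P0 : 0 < (pi : R) by exact: pi_gt0.
have sP : Num.sqrt (pi : R) ^+ 2 = pi by rewrite sqr_sqrtr// ltW.
have sP0 : Num.sqrt (pi : R) != 0 by rewrite gt_eqF// sqrtr_gt0.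
move: im; rewrite leq_eqVlt => /orP[/eqP im|im].
  rewrite im (_ : (2 * m - m = m)%N); last by lia.
  rewrite ltnn eqxx; set s := Num.sqrt (2 * pi).
  have s2 : s ^+ 2 = 2 * pi by rewrite sqr_sqrtr// mulr_ge0// ltW.
  have -> : k = 0 by rewrite /k im subnn.
  rewrite !mul0r cos0 sin0 -s2.
  have s0 : s != 0 by rewrite gt_eqF// sqrtr_gt0 mulr_gt0.
  by field.
rewrite im (_ : (2 * m - i < m)%N = false); last by lia.
rewrite (_ : (2 * m - i == m)%N = false); last by lia.
move: (Num.sqrt (pi : R)) sP sP0 => s sP s0; rewrite -sP.
by move: (cos (k * x)) (cos (k * y)) (sin (k * x)) (sin (k * y)) => *; field.
Qed.

(** Orthonormality over a period collapses the double sum given by [gkerE]; here the integral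
    constraints become linear ones. *)
Lemma kernel_averageE m n (sigma : R) (q : coefs R m) (al : 'I_(2 * n).+1) :
  kernel_average sigma q al = ((Gmx m n sigma)^T *m q) al 0.
Proof.
rewrite /kernel_average.
have -> : \int[lebesgue_measure]_(x in `[0, 2 * pi])
     (gker m sigma (x - gridpt R al) * trig q x) =
  \int[lebesgue_measure]_(x in `[0, 2 * pi])
    (\sum_(p : 'I_(2 * m).+1 * 'I_(2 * m).+1)
      (damping sigma p.1 * trig_basis p.1 (gridpt R al) * q p.2 0) *
      (trig_basis p.1 x * trig_basis p.2 x)).
  apply: eq_Rintegral => x _; rewrite gkerE /trig mulr_suml.
  rewrite -(pair_bigA _ (fun i j => damping sigma i * trig_basis i (gridpt R al) * q j 0 *
    (trig_basis i x * trig_basis j x)))/=.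
  apply: eq_bigr => i _; rewrite mulr_sumr; apply: eq_bigr => j _; ring.
rewrite /Rintegral; under eq_integral do rewrite -sumEFin.
rewrite integral_sum//=; last first.
  move=> p; pose c := damping sigma p.1 * trig_basis p.1 (gridpt R al) * q p.2 0.
  exact: (@integrableZl _ _ _ _ _ _ c _ (trig_basis_integrable p.1 p.2)).
have I0 (p : 'I_(2 * m).+1 * 'I_(2 * m).+1) (c : R) :
  (\int[@lebesgue_measure R]_(x in `[0%R, (2 * pi)%R]) (c * (trig_basis p.1 x * trig_basis p.2 x))%:E
   = (c * (p.1 == p.2)%:R)%:E)%E.
  under eq_integral do rewrite EFinM.
  rewrite integralZl//; last exact: trig_basis_integrable.
  rewrite -(fineK (integrable_fin_num _ (trig_basis_integrable p.1 p.2)))//.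
  by rewrite -/(Rintegral _ _ _) trig_basis_Rintegral_ortho.
under eq_bigr do rewrite I0.
rewrite sumEFin /= -(pair_bigA _ (fun i j =>
  damping sigma i * trig_basis i (gridpt R al) * q j 0 * (i == j)%:R))/=.
rewrite mxE; apply: eq_bigr => i _; rewrite (bigD1 i)//= big1 ?addr0; last first.
  by move=> j ji; rewrite eq_sym (negbTE ji) mulr0.
by rewrite eqxx mulr1 !mxE.
Qed.

End observation_kernel.

Section aliasing.
Context {R : realType}.

Lemma cos_2pi_periodic (x : R) (k : nat) : cos (x + k%:R * (2 * pi)) = cos x.
Proof.
elim: k => [|k IH]; first by rewrite mul0r addr0.
have -> : x + k.+1%:R * (2 * pi) = (x + k%:R * (2 * pi)) + pi *+ 2.
  by rewrite -natr1 -mulr_natr; ring.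
by rewrite cosD2pi.
Qed.

Variable n : nat.
Local Notation N := (2 * n).+1.

Let grid_shift (al : 'I_N) (b : nat) :
  (b * N)%:R * gridpt R al = (b * al)%:R * (2 * pi).
Proof.
rewrite /gridpt !natrM; have := pnatr_eq0 R N; rewrite /=.
by move: (N%:R : R) => M M0; field; rewrite M0.
Qed.

Lemma grid_alias_add (al : 'I_N) (b l : nat) (x := gridpt R al) :
  cos ((b * N + l)%:R * x) = cos (l%:R * x) /\
  sin ((b * N + l)%:R * x) = sin (l%:R * x).
Proof.
rewrite natrD mulrDl grid_shift addrC.
by rewrite cos_2pi_periodic sin_2pi_periodic.
Qed.

Lemma grid_alias_sub (al : 'I_N) (k b l : nat) (x := gridpt R al) :
  (k + l = b * N)%N ->
  cos (k%:R * x) = cos (l%:R * x) /\ sin (k%:R * x) = - sin (l%:R * x).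
Proof.
move=> kl; have -> : k%:R * x = - (l%:R * x) + (b * al)%:R * (2 * pi).
  by rewrite -grid_shift -kl natrD -/x; ring.
by rewrite cos_2pi_periodic sin_2pi_periodic cosN sinN.
Qed.

(* Distance to the nearest multiple of the number of grid points. *)
Lemma folded_wavenumber (k : nat) : exists l : nat, exists neg : bool, exists b : nat,
  [/\ (l <= n)%N, (if neg then k + l = b * N else k = b * N + l)%N,
      (n < k)%N -> (N * (k - n) + l ^ 2 <= k ^ 2)%N & (k <= n)%N -> l = k].
Proof.
have := divn_eq k N; have := ltn_pmod k (ltn0Sn (2 * n)).
move: (k %/ N)%N (k %% N)%N => a r rN kE.
case: (leqP r n) => rn.
  exists r, false, a; split => //.
  - case: a kE => [|a] kE kn; first by lia.
    have NP : (N <= a.+1 * N)%N by rewrite leq_pmull.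
    move: kE NP; move: (a.+1 * N)%N => P -> NP.
    apply: (@leq_trans (N * (P + r) + r ^ 2)).
      by rewrite leq_add2r leq_mul2l leq_subr orbT.
    have h1 := leq_mul NP (leqnn P); have h2 := leq_mul NP (leqnn r).
    rewrite sqrnD mulnDr -!mulnn; move: h1 h2.
    move: (N * P)%N (N * r)%N (P * P)%N (P * r)%N (r * r)%N; lia.
  - case: a kE => [|a] kE kn; first by lia.
    have NP : (N <= a.+1 * N)%N by rewrite leq_pmull.
    by move: kE NP; move: (a.+1 * N)%N; lia.
exists (N - r)%N, true, a.+1; split => //.
- lia.
- by rewrite kE [(a.+1 * N)%N]mulSn; move: (a * N)%N; lia.
- move=> kn; pose e := (r - n.+1)%N.
  have rE : r = (n.+1 + e)%N by rewrite /e; lia.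
  have -> : (N - r = n - e)%N by lia.
  have en : (e <= n)%N by lia.
  have kE' : k = (a * N + n + 1 + e)%N by lia.
  have -> : (k - n = a * N + 1 + e)%N by lia.
  (* With [l = n - e] this is [k^2 - l^2 = (k - l) (k + l)], where [k + l] is a multiple of the
     number of grid points. *)
  have k2 : (k ^ 2 = (n - e) ^ 2 + (a * N + 1 + 2 * e) * (a.+1 * N))%N.
    have [d dn] : exists d, n = (e + d)%N by exists (n - e)%N; lia.
    have -> : (n - e = d)%N by lia.
    by rewrite kE' -!mulnn dn; lia.
  rewrite k2 addnC leq_add2l mulnC.
  by apply: leq_mul; [move: (a * N)%N; lia|rewrite leq_pmull].
- case: a kE => [|a] kE kn; first by lia.
  have NP : (N <= a.+1 * N)%N by rewrite leq_pmull.
  by move: kE NP; move: (a.+1 * N)%N; lia.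
Qed.

(** On the grid a mode is a multiple [c] of the mode of folded frequency. A sine folded with
    reflection has [c = -1], and one folded to frequency 0 vanishes, so [c = 0]. The bound 2 is
    reached by a cosine folded onto the constant mode, whose normalization is smaller by
    [sqrt 2]. *)
Lemma trig_basis_alias m (i : 'I_(2 * m).+1) :
  exists (c : R) (j : 'I_N), [/\ c ^+ 2 <= 2,
    (n < wavenumber i)%N ->
      (N * (wavenumber i - n) + wavenumber j ^ 2 <= wavenumber i ^ 2)%N,
    (wavenumber i <= n)%N -> wavenumber j = wavenumber i &
    forall al : 'I_N, trig_basis i (gridpt R al) = c * trig_basis j (gridpt R al)].
Proof.
have [l [neg [b [ln kE k2 kn]]]] := folded_wavenumber (wavenumber i).
have trigE (al : 'I_N) (x := gridpt R al) :
    cos ((wavenumber i)%:R * x) = cos (l%:R * x) /\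
    sin ((wavenumber i)%:R * x) = (-1) ^+ neg * sin (l%:R * x).
  case: neg kE => kE; last by rewrite kE expr0 mul1r; exact: grid_alias_add.
  by rewrite expr1 mulN1r; exact: grid_alias_sub kE.
(* Positions of the cosine and sine of frequency [l] in the order
   [(a_n, ..., a_0, b_1, ..., b_n)]. *)
have jcos_lt : (n - l < N)%N by lia.
have jsin_lt : (n + l < N)%N by lia.
pose jc := Ordinal jcos_lt; pose js := Ordinal jsin_lt.
have wc : wavenumber jc = l by rewrite /wavenumber /= leq_subr; lia.
have ws : wavenumber js = l.
  by rewrite /wavenumber /=; case: ifP => //; lia.
have sP0 : Num.sqrt (pi : R) != 0 by rewrite gt_eqF// sqrtr_gt0 pi_gt0.
have s2 : Num.sqrt (2 * pi : R) = Num.sqrt 2 * Num.sqrt pi by rewrite sqrtrM.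
have s20 : Num.sqrt (2 : R) != 0 by rewrite gt_eqF// sqrtr_gt0.
have [im|mi] := leqP i m; last first.
  case: (posnP l) => [l0|l0].
    exists 0, js; rewrite ws; split => //; first by rewrite expr0n.
    move=> al; have [_ sE] := trigE al.
    rewrite mul0r /trig_basis; case: ifP; first by lia.
    case: ifP => [|_ _]; first by lia.
    by rewrite sE l0 mul0r sin0 mulr0 mul0r.
  exists ((-1) ^+ neg), js; rewrite ws; split => //; first by rewrite sqrr_sign ler1n.
  move=> al; have [_ sE] := trigE al.
  rewrite /trig_basis ws /=; case: ifP; first by lia.
  case: ifP => [|_ _]; first by lia.
  case: ifP; first by lia.
  case: ifP => [|_ _]; first by lia.
  by rewrite sE mulrA.
case: (posnP l) => [l0|l0]; last first.
  exists 1, jc; rewrite wc; split => //; first by rewrite expr1n ler1n.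
  have im' : (i < m)%N.
    have h : wavenumber i = (m - i)%N by rewrite /wavenumber im.
    case: (leqP m i) => // mi; have /kn : (wavenumber i <= n)%N by lia.
    lia.
  move=> al; have [cE _] := trigE al.
  rewrite /trig_basis wc /= im' cE mul1r.
  by rewrite (_ : (n - l < n)%N) //; lia.
have [im'|im'|im'] := ltngtP i m; last 2 first.
- by lia.
- exists 1, jc; rewrite wc; split => //; first by rewrite expr1n ler1n.
  move=> al; rewrite /trig_basis /= im' ltnn eqxx l0 subn0 ltnn eqxx mul1r //.
exists (Num.sqrt 2), jc; rewrite wc; split => //; first by rewrite sqr_sqrtr.
move=> al; have [cE _] := trigE al.
rewrite /trig_basis /= im' l0 subn0 ltnn eqxx cE l0 mul0r cos0 s2.
by move: (Num.sqrt (pi : R)) sP0 (Num.sqrt (2 : R)) s20 => s ? s' ?; field; apply/andP.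
Qed.

(** The real discrete Fourier matrix, orthogonal up to a scalar. Its invertibility allows the low
    modes of [G y] to be prescribed freely. *)
Definition low_modes : 'M[R]_N := \matrix_(j, al) trig_basis j (gridpt R al).

Lemma low_modesK : low_modes *m low_modes^T = (N%:R / (2 * pi))%:M.
Proof.
apply/matrixP => i j; rewrite mxE; under eq_bigr do rewrite !mxE.
by rewrite trig_basis_grid_ortho !mxE mulr_natr.
Qed.

Lemma low_modes_unit : low_modes \in unitmx.
Proof.
have c0 : (N%:R / (2 * pi) : R) != 0.
  by rewrite mulf_neq0 ?pnatr_eq0// invr_neq0// mulf_neq0// gt_eqF// pi_gt0.
have : low_modes *m ((N%:R / (2 * pi))^-1 *: low_modes^T) = 1%:M.
  by rewrite -scalemxAr low_modesK scale_scalar_mx mulVf.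
by move/mulmx1_unit => [].
Qed.

End aliasing.

(** * Size of the projection residual *)

Section residual.
Context {R : realType} (m n : nat) (sigma : R).
Hypothesis nm : (n <= m)%N.
Local Notation N := (2 * n).+1.
Local Notation G := (Gmx m n sigma).
Local Notation B := (@low_modes R n).

Lemma Gmx_mulE (x : 'cV[R]_N) i : (G *m x) i 0 =
  damping sigma i * \sum_al trig_basis i (gridpt R al) * x al 0.
Proof.
by rewrite mxE mulr_sumr; apply: eq_bigr => al _; rewrite mxE mulrA.
Qed.

Lemma low_mode_le (x : 'cV[R]_N) (j : 'I_N) :
  (expR (- ((wavenumber j)%:R ^+ 2 * sigma ^+ 2 / 4)) * (B *m x) j 0) ^+ 2 <=
  sqnorm (G *m x).
Proof.
(* Both orderings are centred at the constant mode, so indices of degree [n] shift by [m - n] in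
   degree [m]. *)
have lt : (j + (m - n) < (2 * m).+1)%N by have := ltn_ord j; lia.
pose i : 'I_(2 * m).+1 := Ordinal lt.
have wE : wavenumber i = wavenumber j.
  by rewrite /wavenumber /=; case: ifP; case: ifP; lia.
have tE y : trig_basis i y = trig_basis j y :> R.
  rewrite /trig_basis wE /=.
  rewrite (_ : (j + (m - n) < m)%N = (j < n)%N); last by lia.
  by rewrite (_ : (j + (m - n) == m)%N = (j == n :> nat)); last by lia.
have -> : expR (- ((wavenumber j)%:R ^+ 2 * sigma ^+ 2 / 4)) * (B *m x) j 0 =
    (G *m x) i 0.
  rewrite Gmx_mulE /damping wE mxE; congr (_ * _).
  by apply: eq_bigr => al _; rewrite mxE tE.
rewrite /sqnorm (bigD1 i)//= lerDl.
by apply: sumr_ge0 => l _; exact: sqr_ge0.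
Qed.

Lemma Gmx_inj (x : 'cV[R]_N) : G *m x = 0 -> x = 0.
Proof.
move=> Gx0; suff : B *m x = 0.
  by move=> /(congr1 (mulmx (invmx B))); rewrite mulKmx ?low_modes_unit// mulmx0.
apply/colP => j; rewrite [RHS]mxE; have := low_mode_le x j.
rewrite (_ : sqnorm (G *m x) = 0); last by rewrite Gx0 sqnormE mulmx0 mxE.
move=> h; have /eqP := le_anti (introT andP (conj h (sqr_ge0 _))).
by rewrite sqrf_eq0 mulf_eq0 gt_eqF ?expR_gt0//= => /eqP.
Qed.

Lemma geometric_tail_le (M : nat) :
  \sum_(0 <= k < M) (if (n < k)%N then (4^-1 : R) ^+ (k - n.+1) else 0) <= 4 / 3.
Proof.
(* The remaining tail is added so that the induction closes; truncated subtraction keeps it at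
   [4 / 3] up to [M = n.+1]. *)
suff : \sum_(0 <= k < M) (if (n < k)%N then (4^-1 : R) ^+ (k - n.+1) else 0) +
    4 / 3 * 4^-1 ^+ (M - n.+1) <= 4 / 3.
  have : 0 <= 4 / 3 * 4^-1 ^+ (M - n.+1) :> R by rewrite mulr_ge0// exprn_ge0.
  lra.
elim: M => [|M IH]; first by rewrite big_nil sub0n expr0; lra.
rewrite big_nat_recr//=; case: ifPn => nM.
  apply: le_trans IH; rewrite subSn// exprS; lra.
by move: IH; rewrite (_ : (M - n.+1 = M.+1 - n.+1)%N) ?addr0//; lia.
Qed.

(** Each positive frequency occurs as one cosine and one sine, which gives two geometric tails. *)
Lemma high_modes_sum_le :
  \sum_(i < (2 * m).+1) (if (n < wavenumber i)%N
    then (4^-1 : R) ^+ (wavenumber i - n.+1) else 0) <= 8 / 3.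
Proof.
pose f k : R := if (n < k)%N then (4^-1 : R) ^+ (k - n.+1) else 0.
pose w (i : nat) := if (i <= m)%N then (m - i)%N else (i - m)%N.
rewrite -(big_mkord xpredT (fun i => f (w i))).
rewrite (@big_cat_nat _ _ _ m.+1)//=; last by lia.
rewrite [8 / 3](_ : _ = 4 / 3 + 4 / 3); last by lra.
apply: lerD.
  rewrite big_nat_rev /=; apply: le_trans (geometric_tail_le m.+1).
  rewrite le_eqVlt; apply/orP; left; apply/eqP.
  apply: eq_big_nat => i im; rewrite -/(f i) /w.
  by rewrite ifT; [congr f|]; lia.
apply: le_trans (geometric_tail_le m.+1).
rewrite -{1}[m.+1]add0n big_addn (_ : ((2 * m).+1 - m.+1 = m)%N); last by lia.
rewrite big_nat_recl// -[leLHS]add0r; apply: lerD => //.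
rewrite le_eqVlt; apply/orP; left; apply/eqP.
apply: eq_big_nat => i im; rewrite -/(f i.+1) /w.
by rewrite ifF; [congr f|]; lia.
Qed.

(** [16 / 3] is the 2 bounding [c^2] in [trig_basis_alias] times the [8 / 3] of
    [high_modes_sum_le]. *)
Definition residual_const : R := 16 / 3 * N%:R * expR (- (N%:R * sigma ^+ 2 / 2)).

Hypothesis sigma_wide : 3 <= N%:R * sigma ^+ 2 / 2.

(** Put [y = d / N], so [y - 1 >= j]. Since [y <= exp (y - 1)] and the rate [N sigma^2 / 2] is at
    least 3, the factor beyond the first exponential is at most [exp (-2 (y - 1))], and
    [exp 2 >= 4]. *)
Lemma high_mode_decay (d : R) (j : nat) :
  N%:R * j.+1%:R <= d ->
  d * expR (- (d * sigma ^+ 2 / 2)) <=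
  N%:R * expR (- (N%:R * sigma ^+ 2 / 2)) * 4^-1 ^+ j.
Proof.
move=> dj; have N0 : 0 < N%:R :> R by rewrite ltr0n.
pose y := d / N%:R; have yE : d = N%:R * y by rewrite /y mulrCA mulfV ?mulr1// gt_eqF.
have yj : j%:R <= y - 1.
  by rewrite lerBrDr natr1 -(ler_pM2l N0) -yE.
have sw := sigma_wide; set be := N%:R * sigma ^+ 2 / 2 in sw *.
have -> : d * sigma ^+ 2 / 2 = be + be * (y - 1) by rewrite yE /be; field.
clearbody be y; have j0 : 0 <= j%:R :> R by rewrite ler0n.
rewrite opprD expRD yE -!mulrA ler_wpM2l ?(ltW N0)//.
rewrite mulrCA ler_wpM2l ?expR_ge0//.
have y0 : 0 <= y by lra.
have e1 : y <= expR (y - 1) by have := expR_ge1Dx (y - 1); rewrite addrC subrK.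
apply: (@le_trans _ _ (expR (y - 1) * expR (- (3 * (y - 1))))).
  apply: ler_pM => //; rewrite ler_expR lerN2; apply: ler_wpM2r => //; lra.
rewrite -expRD; apply: (@le_trans _ _ (expR (- 2 * j%:R))).
  rewrite ler_expR; lra.
rewrite expRM_natr lerXn2r// ?nnegrE ?expR_ge0//.
rewrite expRN lef_pV2 ?posrE ?expR_gt0//.
have := expR_ge1Dx (1 : R).
have -> : (2 : R) = 1 + 1 by [].
rewrite expRD; nra.
Qed.

(** In coordinates this is [Lambda (G x - Lambda^-2 G y)], the displacement part of the residual in
    energy norm. *)
Lemma residual_le (x : 'cV[R]_N) : exists y : 'cV[R]_N,
  \sum_i (omega R (wavenumber i) * (G *m x) i 0 -
          (omega R (wavenumber i))^-1 * (G *m y) i 0) ^+ 2 <=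
  residual_const * sqnorm (G *m x).
Proof.
pose om k := omega R k.
have om2 k : om k ^+ 2 = k%:R ^+ 2 + 1 by rewrite sqr_sqrtr// addr_ge0// sqr_ge0.
have om0 k : 0 < om k by rewrite sqrtr_gt0 ltr_wpDl// sqr_ge0.
(* [y] cancels the modes [j] of frequency at most [n]; a mode [i] aliased to [j]
   keeps the factor [1 - om_j^2 / om_i^2]. *)
pose Y : 'cV[R]_N := \col_j (om (wavenumber j) ^+ 2 * (B *m x) j 0).
exists (invmx B *m Y).
have BY j : (B *m (invmx B *m Y)) j 0 = om (wavenumber j) ^+ 2 * (B *m x) j 0.
  by rewrite mulKVmx ?low_modes_unit// mxE.
have term (i : 'I_(2 * m).+1) : (om (wavenumber i) * (G *m x) i 0 -
    (om (wavenumber i))^-1 * (G *m (invmx B *m Y)) i 0) ^+ 2 <=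
    2 * N%:R * expR (- (N%:R * sigma ^+ 2 / 2)) * sqnorm (G *m x) *
    (if (n < wavenumber i)%N then (4^-1 : R) ^+ (wavenumber i - n.+1) else 0).
  have [c [j [c2 khi klo tE]]] := @trig_basis_alias R n m i.
  set ki := wavenumber i in khi klo *; set kj := wavenumber j in khi klo *.
  have GE (z : 'cV[R]_N) : (G *m z) i 0 = damping sigma i * (c * (B *m z) j 0).
    rewrite Gmx_mulE [in RHS]mxE; congr (_ * _); rewrite mulr_sumr.
    by apply: eq_bigr => al _; rewrite mxE tE mulrA.
  rewrite !GE BY -/kj; set b := (B *m x) j 0.
  have -> : om ki * (damping sigma i * (c * b)) -
      (om ki)^-1 * (damping sigma i * (c * (om kj ^+ 2 * b))) =
      damping sigma i * c * b * ((om ki ^+ 2 - om kj ^+ 2) / om ki).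
    by field; rewrite gt_eqF// om0.
  (* Up to frequency [n] nothing is folded, so the factor [om_i^2 - om_j^2] vanishes. *)
  case: ifPn => [nk|]; last first.
    rewrite -leqNgt => /klo ->.
    by rewrite subrr mul0r mulr0 expr0n mulr0.
  have /khi := nk; rewrite -(ler_nat R) natrD natrM !natrX => dle.
  have jE : (ki - n = (ki - n.+1).+1)%N by lia.
  rewrite jE in dle.
  pose d : R := ki%:R ^+ 2 - kj%:R ^+ 2.
  have dle' : N%:R * (ki - n.+1).+1%:R <= d by rewrite /d; lra.
  have d0 : 0 <= d by apply: le_trans dle'; rewrite mulr_ge0 ?ler0n.
  have dE : om ki ^+ 2 - om kj ^+ 2 = d by rewrite !om2 /d; ring.
  (* The squared damping of [i] is that of [j] times [exp (- d sigma^2 / 2)]. One factor [d] joins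
     this exponential for [high_mode_decay]; the other is absorbed by [om_i^2 >= d]. *)
  have -> : (damping sigma i * c * b * ((om ki ^+ 2 - om kj ^+ 2) / om ki)) ^+ 2 =
    (c ^+ 2 * (expR (- (kj%:R ^+ 2 * sigma ^+ 2 / 4)) * b) ^+ 2) *
    (d * expR (- (d * sigma ^+ 2 / 2))) * (d / om ki ^+ 2).
    rewrite dE; have dmp : damping sigma i ^+ 2 = expR (- (kj%:R ^+ 2 * sigma ^+ 2 / 4)) ^+ 2 * expR (- (d * sigma ^+ 2 / 2)) :> R.
      rewrite /damping -!expRM_natl -expRD; congr expR; rewrite -/ki /d; by field.
    transitivity (damping sigma i ^+ 2 * c ^+ 2 * b ^+ 2 * d ^+ 2 / om ki ^+ 2).
      by field; rewrite gt_eqF// om0.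
    by rewrite dmp; field; rewrite gt_eqF// om0.
  have dom : d / om ki ^+ 2 <= 1.
    rewrite ler_pdivrMr ?exprn_gt0// mul1r om2 /d.
    by have := sqr_ge0 (kj%:R : R); lra.
  set D := sqnorm _; have D0 : 0 <= D by exact: sqnorm_ge0.
  apply: (@le_trans _ _ ((2 * D) * (N%:R * expR (- (N%:R * sigma ^+ 2 / 2)) * 4^-1 ^+ (ki - n.+1)) * 1)).
    apply: ler_pM => //.
    - apply: mulr_ge0; first by apply: mulr_ge0; exact: sqr_ge0.
      by apply: mulr_ge0 => //; exact: expR_ge0.
    - by rewrite divr_ge0// sqr_ge0.
    - apply: ler_pM.
      + by apply: mulr_ge0; exact: sqr_ge0.
      + by apply: mulr_ge0 => //; exact: expR_ge0.
      + by apply: ler_pM => //; [exact: sqr_ge0|exact: sqr_ge0|exact: low_mode_le].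
      + exact: high_mode_decay.
  by rewrite le_eqVlt; apply/orP; left; apply/eqP; ring.
apply: le_trans (ler_sum _ (fun i _ => term i)) _.
rewrite -mulr_sumr; set D := sqnorm _.
apply: le_trans (ler_wpM2l _ high_modes_sum_le) _.
  by rewrite !mulr_ge0 ?expR_ge0 ?sqnorm_ge0 ?ler0n.
by rewrite /residual_const le_eqVlt; apply/orP; left; apply/eqP; field.
Qed.

End residual.

(** * The Klein-Gordon system *)

Section klein_gordon_matrices.
Context {R : realType} (m : nat).
Local Notation M := (2 * m).+1.
Local Notation La := (Lambda R m).

Lemma sqnorm_col_mx a b (x : 'cV[R]_a) (y : 'cV[R]_b) :
  sqnorm (col_mx x y) = sqnorm x + sqnorm y.
Proof.
rewrite /sqnorm big_split_ord /=; congr (_ + _); apply: eq_bigr => i _.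
  by rewrite col_mxEu.
by rewrite col_mxEd.
Qed.

Lemma omega_sqr k : omega R k ^+ 2 = k%:R ^+ 2 + 1.
Proof. by rewrite sqr_sqrtr// addr_ge0// sqr_ge0. Qed.

Lemma omega_gt0 k : 0 < omega R k.
Proof. by rewrite sqrtr_gt0 ltr_wpDl// sqr_ge0. Qed.

Lemma omega_sqr_ge1 k : 1 <= omega R k ^+ 2.
Proof. by rewrite omega_sqr lerDr sqr_ge0. Qed.

Lemma Lambda_mulE k (q : 'M[R]_(M, k)) i j :
  (La *m q) i j = omega R (wavenumber i) * q i j.
Proof. by rewrite mul_diag_mx !mxE. Qed.

Lemma Lambda_tr : La^T = La.
Proof. exact: tr_diag_mx. Qed.

Lemma Lambda_sqrE : La *m La = diag_mx (\row_i (omega R (wavenumber i) ^+ 2)).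
Proof. by rewrite mulmx_diag; congr diag_mx; apply/rowP => i; rewrite !mxE. Qed.

Lemma Lambda_sqr_inv :
  (La *m La) *m diag_mx (\row_i (omega R (wavenumber i) ^+ 2)^-1) = 1%:M.
Proof.
rewrite Lambda_sqrE mulmx_diag -diag_const_mx; congr diag_mx; apply/rowP => i.
by rewrite !mxE mulfV// gt_eqF// exprn_gt0// omega_gt0.
Qed.

Lemma Lambda_sqr_unit : La *m La \in unitmx.
Proof. by have /mulmx1_unit[] := Lambda_sqr_inv. Qed.

Lemma invmx_Lambda_sqr :
  invmx (La *m La) = diag_mx (\row_i (omega R (wavenumber i) ^+ 2)^-1).
Proof.
rewrite -[RHS]mul1mx -(mulVmx Lambda_sqr_unit) -mulmxA Lambda_sqr_inv.
by rewrite mulmx1.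
Qed.

Lemma Amx_unit : Amx R m \in unitmx.
Proof. by rewrite block_diag_mx_unit Lambda_sqr_unit unitmx1. Qed.

Lemma invmx_Amx : invmx (Amx R m) = block_mx (invmx (La *m La)) 0 0 1%:M.
Proof. by rewrite invmx_block_diag ?invmx1// Amx_unit. Qed.

Lemma Amx_sqrtE : Amx R m = (Amx_sqrt R m)^T *m Amx_sqrt R m.
Proof.
rewrite /Amx_sqrt tr_block_mx !trmx0 trmx1 Lambda_tr mulmx_block.
by rewrite !mulmx0 !mul0mx !mulmx1 !addr0 !add0r.
Qed.

Lemma Amx_sqrt_mul (q p : 'cV[R]_M) :
  Amx_sqrt R m *m col_mx q p = col_mx (La *m q) p.
Proof. by rewrite mul_block_col !mul0mx mul1mx addr0 add0r. Qed.

Lemma Lmx_mul (q p : 'cV[R]_M) :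
  Lmx R m *m col_mx q p = col_mx p (- (La *m La) *m q).
Proof. by rewrite mul_block_col !mul0mx mul1mx addr0 add0r. Qed.

Lemma Amx_sqrt_ge1 (z : phase R m) : sqnorm z <= sqnorm (Amx_sqrt R m *m z).
Proof.
rewrite -[z]vsubmxK Amx_sqrt_mul !sqnorm_col_mx lerD2r.
apply: ler_sum => i _; rewrite Lambda_mulE exprMn ler_peMl ?sqr_ge0//.
exact: omega_sqr_ge1.
Qed.

Lemma Amx_ge1 (z : phase R m) : sqnorm z <= (z^T *m Amx R m *m z) 0 0.
Proof. by rewrite (energy_form_sqnorm Amx_sqrtE) Amx_sqrt_ge1. Qed.

(** Infinitesimal conservation of the Klein-Gordon energy: the two blocks contribute
    [p^T Lambda^2 q] and its opposite. *)
Lemma Lmx_energy_skew (z : phase R m) :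
  ((Amx_sqrt R m *m (Lmx R m *m z))^T *m (Amx_sqrt R m *m z)) 0 0 = 0.
Proof.
rewrite -[z]vsubmxK Lmx_mul !Amx_sqrt_mul tr_col_mx mul_row_col.
set q := usubmx _; set p := dsubmx _.
have -> : (- (La *m La) *m q)^T = - (q^T *m (La *m La)).
  by rewrite mulNmx linearN/= !trmx_mul Lambda_tr.
rewrite mulNmx.
have -> : q^T *m (La *m La) *m p = ((La *m p)^T *m (La *m q))^T.
  by rewrite !trmx_mul !trmxK Lambda_tr !mulmxA.
by rewrite mxE [X in _ + X]mxE [X in _ - X]mxE subrr.
Qed.

(** [A^-1] removes the [Lambda^2] of [L] and leaves the canonical symplectic matrix. *)
Lemma KmxE : Kmx R m = block_mx 0 1%:M (- 1%:M) 0.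
Proof.
rewrite /Kmx invmx_Amx /Lmx mulmx_block !mul0mx !mulmx0 !mulmx1 !addr0 !add0r.
by rewrite mulNmx mulmxV// Lambda_sqr_unit.
Qed.

Lemma Kmx_skew : (Kmx R m)^T = - Kmx R m.
Proof.
rewrite KmxE tr_block_mx !trmx0 trmx1 opp_block_mx !oppr0 opprK.
by rewrite linearN /= trmx1.
Qed.

Lemma Kmx_mul (q p : 'cV[R]_M) : Kmx R m *m col_mx q p = col_mx p (- q).
Proof. by rewrite KmxE mul_block_col !mul0mx mul1mx mulNmx mul1mx addr0 add0r. Qed.

Lemma invmx_Amx_mul (q p : 'cV[R]_M) :
  invmx (Amx R m) *m col_mx q p = col_mx (invmx (La *m La) *m q) p.
Proof. by rewrite invmx_Amx mul_block_col !mul0mx mul1mx addr0 add0r. Qed.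

Lemma trig_coef_sum (q : coefs R m) i : q i 0 =
  \sum_(al < M) (2 * pi / M%:R * trig_basis i (gridpt R al)) * trig q (gridpt R al).
Proof.
by rewrite [LHS]trig_coef mulr_sumr; apply: eq_bigr => al _; rewrite [trig q _ * _]mulrC mulrA.
Qed.

Lemma is_derive_coef (q : R -> coefs R m) (t : R) (y : coefs R m) :
  (forall x, is_derive t (1 : R) (fun s => trig (q s) x) (trig y x)) ->
  is_vderive q t y.
Proof.
move=> qy i.
rewrite (_ : (fun s => _) = \sum_(al < M)
    (fun s => (2 * pi / M%:R * trig_basis i (gridpt R al)) * trig (q s) (gridpt R al))).
  by rewrite (trig_coef_sum y); apply: is_derive_sum.
by apply/funext => s; rewrite fct_sumE [LHS]trig_coef_sum.
Qed.

Lemma trig_second_derivative (q : coefs R m) (x : R) :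
  derive1n 2 (trig q) x - trig q x = trig (- (La *m La) *m q) x.
Proof.
rewrite trig_derive1n2 /trig -opprD -big_split/= -sumrN.
apply: eq_bigr => i _; rewrite mulNmx mxE Lambda_sqrE mul_diag_mx !mxE omega_sqr.
by ring.
Qed.

Lemma KG_solution_ode (z : R -> phase R m) :
  KG_solution z -> forall s, is_vderive z s (Lmx R m *m z s).
Proof.
move=> zKG s i.
have hq : is_vderive (fun s => qpart (z s)) s (ppart (z s)).
  by apply: is_derive_coef => x; have [] := zKG s x.
have hp : is_vderive (fun s => ppart (z s)) s (- (La *m La) *m qpart (z s)).
  by apply: is_derive_coef => x; rewrite -trig_second_derivative; have [] := zKG s x.
rewrite -[z s in X in is_derive _ _ _ X]vsubmxK Lmx_mul.
have [j ->|j ->] := split_ordP i.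
  rewrite col_mxEu; have := hq j.
  by rewrite (_ : (fun s => qpart (z s) j 0) = (fun s => z s (lshift M j) 0))//;
    apply/funext => s'; rewrite mxE.
rewrite col_mxEd; have := hp j.
by rewrite (_ : (fun s => ppart (z s) j 0) = (fun s => z s (rshift M j) 0))//;
  apply/funext => s'; rewrite mxE.
Qed.

Lemma normAE (z : phase R m) : normA z = Num.sqrt (sqnorm (Amx_sqrt R m *m z)).
Proof. by []. Qed.

Definition energy_weights : 'rV[R]_(M + M) :=
  row_mx (\row_i (omega R (wavenumber i) ^+ 2)) (const_mx 1).

Lemma Amx_diag : Amx R m = diag_mx energy_weights.
Proof. by rewrite diag_mx_row diag_const_mx -Lambda_sqrE. Qed.

Lemma energy_weights_ge1 i : 1 <= energy_weights 0 i.
Proof.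
have [j ->|j ->] := split_ordP i; rewrite ?row_mxEl ?row_mxEr !mxE//.
exact: omega_sqr_ge1.
Qed.

End klein_gordon_matrices.

Section observations.
Context {R : realType} (m n : nat) (sigma : R).
Hypothesis nm : (n <= m)%N.
Local Notation M := (2 * m).+1.
Local Notation N := (2 * n).+1.
Local Notation La := (Lambda R m).
Local Notation G := (Gmx m n sigma).
Local Notation C := (GGmx m n sigma).

Lemma GGmx_mul (u1 u2 : 'cV[R]_N) : C *m col_mx u1 u2 = col_mx (G *m u1) (G *m u2).
Proof. by rewrite mul_block_col !mul0mx addr0 add0r. Qed.

Lemma GGmx_tr_mul (q p : 'cV[R]_M) : C^T *m col_mx q p = col_mx (G^T *m q) (G^T *m p).
Proof. by rewrite tr_block_mx !trmx0 mul_block_col !mul0mx addr0 add0r. Qed.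

Lemma GGmx_inj (u : obs R n) : C *m u = 0 -> u = 0.
Proof.
rewrite -[u]vsubmxK GGmx_mul -[in X in _ = X -> _]col_mx0 => /eq_col_mx[h1 h2].
by rewrite (Gmx_inj nm h1) (Gmx_inj nm h2) col_mx0.
Qed.

Lemma constrainedE (v0 : obs R n) :
  @constrained R m n sigma v0 = [set z | C^T *m z = v0].
Proof.
apply/seteqP; split => z /= h.
  rewrite -[z]vsubmxK -[v0]vsubmxK GGmx_tr_mul.
  by congr col_mx; apply/colP => al; have [] := h al; rewrite !kernel_averageE.
by move=> al; rewrite !kernel_averageE -h -[in C^T *m z](vsubmxK z) GGmx_tr_mul
  col_mxKu col_mxKd.
Qed.

(** [K] sends [(G u1, G u2)] to [(G u2, - G u1)]. On the momentum block [A] is the identity, so the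
    choice [- u1] cancels that component exactly; only the displacement block needs
    [residual_le]. *)
Lemma projection_bound (u : obs R n) : 3 <= N%:R * sigma ^+ 2 / 2 ->
  exists y : obs R n,
  sqnorm (Amx_sqrt R m *m (Kmx R m *m C *m u - invmx (Amx R m) *m (C *m y))) <=
  residual_const n sigma * (u^T *m Mmx m n sigma *m u) 0 0.
Proof.
move=> sw.
have res0 : 0 <= residual_const n sigma.
  by rewrite !mulr_ge0 ?expR_ge0 ?ler0n//.
rewrite (gram_sqnorm C (Amx_sqrtE m) (Amx_unit m)).
rewrite -[u]vsubmxK; set u1 := usubmx u; set u2 := dsubmx u.
have [y' hy'] := residual_le nm sw u2.
exists (col_mx y' (- u1)).
rewrite -mulmxA !GGmx_mul Kmx_mul !invmx_Amx_mul opp_col_mx add_col_mx.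
rewrite mulmxN opprK addNr !Amx_sqrt_mul !sqnorm_col_mx.
rewrite [X in _ + X](_ : _ = 0); last by rewrite sqnormE mulmx0 mxE.
rewrite addr0; apply: le_trans (ler_wpM2l res0 (_ : sqnorm (G *m u2) <= _)); last first.
  by rewrite lerDr sqnorm_ge0.
apply: le_trans hy'; rewrite le_eqVlt; apply/orP; left; apply/eqP.
apply: eq_bigr => i _; rewrite Lambda_mulE invmx_Lambda_sqr.
rewrite mxE [X in _ + X]mxE mul_diag_mx !mxE -/((G *m u2) i 0) -/((G *m y') i 0).
congr (_ ^+ 2).
set a := \sum_j _; set b := \sum_j _.
by field; rewrite gt_eqF// omega_gt0.
Qed.

End observations.

Section conditional_mean.
Context {R : realType} (m n : nat) (sigma : R).
Hypothesis nm : (n <= m)%N.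
Local Notation A := (Amx R m).
Local Notation C := (GGmx m n sigma).
Local Notation Mm := (Mmx m n sigma).

Lemma Mmx_unit : Mm \in unitmx.
Proof.
by apply: (gram_unit (Amx_sqrtE m) (Amx_unit m)); [exact: Amx_sqrt_ge1|exact: GGmx_inj].
Qed.

Lemma Mmx_inv_sym : (invmx Mm)^T = invmx Mm.
Proof. exact: (inv_gram_sym C (Amx_sqrtE m)). Qed.

Lemma exact_averageE (Phi : phase R m -> R -> phase R m) (v0 : obs R n) (t : R) :
  KG_flow Phi -> 0 <= t ->
  exact_average sigma Phi v0 t = Phi (invmx A *m C *m invmx Mm *m v0) t.
Proof.
move=> PhiKG t0.
have PhiL z : Phi z 0 = z /\ forall s, is_vderive (Phi z) s (Lmx R m *m Phi z s).
  by have [? /KG_solution_ode] := PhiKG z.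
have [E EP] := linear_ode_flow (@Amx_sqrt_ge1 R m) (@Lmx_energy_skew R m) t0 PhiL.
set zs := _ *m v0.
have zsP : C^T *m zs = v0.
  by rewrite /zs !mulmxA -/(Mmx m n sigma) mulmxV ?mul1mx// Mmx_unit.
rewrite /exact_average constrainedE EP.
apply: restricted_meanE.
- exact: (energy_form_sym (Amx_sqrtE m)).
- exact: Amx_ge1.
- exact: EP.
- exact: zsP.
- move=> z /= Cz.
  (* [A zs] lies in the range of [C], hence is orthogonal to differences of constrained points: [zs]
     is the constrained point of least energy. *)
  have -> : zs^T *m A = (C *m (invmx Mm *m v0))^T.
    rewrite -[in RHS](mulKVmx (Amx_unit m) (C *m (invmx Mm *m v0))).
    by rewrite [RHS]trmx_mul (energy_form_sym (Amx_sqrtE m)) /zs !mulmxA.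
  by rewrite trmx_mul -mulmxA mulmxBr Cz zsP subrr mulmx0 mxE.
- exact: exists_restricted_mean zsP.
Qed.

Lemma Mmx_inv_form_ge0 (w : obs R n) : 0 <= (w^T *m invmx Mm *m w) 0 0.
Proof.
have -> : w^T *m invmx Mm *m w = (invmx Mm *m w)^T *m Mm *m (invmx Mm *m w).
  by rewrite trmx_mul Mmx_inv_sym mulmxKV ?Mmx_unit// mulmxA.
by rewrite (gram_sqnorm C (Amx_sqrtE m) (Amx_unit m)) sqnorm_ge0.
Qed.

Lemma observed_form (z : phase R m) :
  z^T *m (C *m invmx Mm *m C^T) *m z = (C^T *m z)^T *m invmx Mm *m (C^T *m z).
Proof. by rewrite trmx_mul trmxK !mulmxA. Qed.

(** Cyclicity turns the trace of [C M^-1 C^T A^-1] into that of [M^-1 M]. This is the mean of [H]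
    under the Gaussian. *)
Lemma observed_form_trace :
  \sum_i (C *m invmx Mm *m C^T) i i / energy_weights m 0 i = ((2 * n).+1 + (2 * n).+1)%:R :> R.
Proof.
have w0 i : energy_weights m 0 i != 0 :> R.
  by rewrite gt_eqF// (lt_le_trans ltr01)// energy_weights_ge1.
have invA : invmx A = diag_mx (\row_i (energy_weights m 0 i)^-1).
  have inv : A *m diag_mx (\row_i (energy_weights m 0 i)^-1) = 1%:M.
    rewrite Amx_diag mulmx_diag -diag_const_mx; congr diag_mx; apply/rowP => i.
    by rewrite mxE [X in _ * X]mxE mulfV// mxE.
  by rewrite -[RHS]mul1mx -(mulVmx (Amx_unit m)) -mulmxA inv mulmx1.
transitivity (\tr (C *m invmx Mm *m C^T *m invmx A)).
  by apply: eq_bigr => i _; rewrite invA mul_mx_diag [RHS]mxE [X in _ = _ * X]mxE.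
rewrite -!mulmxA mxtrace_mulC -!mulmxA [C^T *m _]mulmxA -/(Mmx m n sigma).
by rewrite mulVmx ?Mmx_unit// mxtrace1.
Qed.

Lemma averages_error (Phi : phase R m -> R -> phase R m) (v : R -> obs R n)
    (v0 : obs R n) (t : R) :
  3 <= (2 * n).+1%:R * sigma ^+ 2 / 2 ->
  KG_flow Phi -> approx_evolution m sigma v0 v -> 0 <= t ->
  normA (exact_average sigma Phi v0 t - approx_average m sigma (v t)) <=
  Num.sqrt (residual_const n sigma * (v0^T *m invmx Mm *m v0) 0 0) * t.
Proof.
move=> sw PhiKG [v00 vS] t0; rewrite exact_averageE// normAE.
set zs := invmx A *m C *m invmx Mm *m v0.
have res0 : 0 <= residual_const n sigma.
  by rewrite !mulr_ge0 ?expR_ge0 ?ler0n//.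
have [Phi0 /KG_solution_ode PhiL] := PhiKG zs.
have := @optimal_prediction_error R _ _ _ _ (Lmx R m) C (Amx_sqrtE m) (Amx_unit m)
  (@Amx_sqrt_ge1 R m) (@Lmx_energy_skew R m) (@GGmx_inj _ _ _ sigma nm) (@Kmx_skew R m)
  (Num.sqrt (residual_const n sigma)) (Phi zs) v t (sqrtr_ge0 _) t0.
rewrite sqr_sqrtr// => H.
have {}H := H (fun u => projection_bound nm u sw) PhiL vS.
rewrite v00 Phi0 in H; have {}H := H erefl.
rewrite -[leRHS]ger0_norm ?mulr_ge0 ?sqrtr_ge0// -sqrtr_sqr ler_wsqrtr//.
apply: le_trans H _; rewrite !exprMn !sqr_sqrtr ?(mulr_ge0 res0) ?Mmx_inv_form_ge0//.
by rewrite le_eqVlt; apply/orP; left; apply/eqP; ring.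
Qed.

End conditional_mean.

(** * Constants under the width condition, and the conclusion *)

Section width.
Context {R : realType} (n : nat) (nu sigma : R).
Hypothesis n1 : (1 <= n)%N.
Hypothesis nu0 : 0 < nu.
Local Notation N := (2 * n).+1.
Hypothesis width : 6 * (nu + 1) * ln N%:R <= N%:R * sigma ^+ 2.

Let N_ge3 : 3 <= N%:R :> R.
Proof. by rewrite ler_nat; lia. Qed.

Let ln_ge1 : 1 <= ln (N%:R : R).
Proof.
rewrite -[leLHS]expRK ler_ln ?posrE ?expR_gt0 ?ltr0n//.
apply: le_trans N_ge3.
(* [exp 1 <= (6/5)^6 < 3] *)
have e6 : expR (6^-1) <= 6 / 5 :> R.
  rewrite -[6^-1]opprK expRN -[6 / 5]invrK lef_pV2 ?posrE ?expR_gt0 ?invr_gt0 ?divr_gt0//.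
  by apply: le_trans (expR_ge1Dx _); lra.
have -> : expR 1 = expR (6^-1) ^+ 6 :> R by rewrite -expRM_natl divff.
apply: (@le_trans _ _ ((6 / 5) ^+ 6)); last lra.
by rewrite lerXn2r// nnegrE ?expR_ge0// divr_ge0.
Qed.

(** Half of the width condition is [3 (nu + 1) ln N], and [ln N >= 1]; this supplies the rate
    assumed in [high_mode_decay]. *)
Lemma width_ge3 : 3 <= N%:R * sigma ^+ 2 / 2.
Proof.
move: ln_ge1 width; move: (ln _) (N%:R * _) => l s l1 w.
have : 0 <= nu * l by rewrite mulr_ge0 ?(ltW nu0)//; lra.
lra.
Qed.

Lemma residual_const_le :
  residual_const n sigma <= 16 / 3 / (N%:R ^+ 2 * (N%:R `^ nu) ^+ 3).
Proof.
have N0 : 0 < N%:R :> R by have := N_ge3; lra.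
have p0 : 0 < N%:R `^ nu by rewrite powR_gt0.
have e : expR (- (N%:R * sigma ^+ 2 / 2)) <= (N%:R * N%:R `^ nu)^-1 ^+ 3.
  have -> : (N%:R * N%:R `^ nu)^-1 ^+ 3 = expR (- (3 * ((nu + 1) * ln N%:R))) :> R.
    rewrite -{1}(lnK N0) /powR gt_eqF// -expRD -expRN -expRM_natl.
    by congr expR; ring.
  by rewrite ler_expR; have := width; lra.
rewrite /residual_const.
apply: (@le_trans _ _ (16 / 3 * N%:R * (N%:R * N%:R `^ nu)^-1 ^+ 3)).
  by rewrite ler_wpM2l// mulr_ge0// ltW.
rewrite le_eqVlt; apply/orP; left; apply/eqP.
by field; rewrite !gt_eqF.
Qed.

End width.

(** Everything reduces to [64 < 5 * a^2 * q], which follows from [5 * 5 * 3 = 75]. The factor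
    [6 / 5] comes from [gauss_moment_diag] and [2 * q] from the trace; the slack makes the final
    probability bound strict. *)
Lemma markov_constant (R : realType) (a p q : R) :
  5 <= a ^+ 2 -> 3 <= q -> 0 < p ->
  6 / 5 * (2 * q) / ((a / p) ^+ 2 / (16 / 3 / (q ^+ 2 * p ^+ 3))) < p^-1.
Proof.
move=> a5 q3 p0; have q0 : 0 < q by exact: lt_le_trans q3.
have a0 : a != 0 by apply/eqP => az; move: a5; rewrite az expr0n/=; lra.
rewrite [ltLHS](_ : _ = 64 / (5 * a ^+ 2 * q) * p^-1); last first.
  by field; rewrite a0 !gt_eqF.
have aq : 5 * 3 <= a ^+ 2 * q by apply: ler_pM.
rewrite gtr_pMl ?invr_gt0// ltr_pdivrMr; first by rewrite mul1r -mulrA; lra.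
by rewrite -mulrA; lra.
Qed.

Theorem theorem1 (R : realType) (n r m : nat) (nu sigma : R)
    (hn : (1 <= n)%N) (hm : m = (n + r * (2 * n).+1)%N)
    (hnu : 0 < nu) (hsigma : 0 < sigma)
    (hwidth : 6 * (nu + 1) * ln (2 * n).+1%:R <= (2 * n).+1%:R * sigma ^+ 2)
    (Phi : phase R m -> R -> phase R m) (hPhi : KG_flow Phi)
    (v : obs R n -> R -> obs R n)
    (hv : forall v0 : obs R n, approx_evolution m sigma v0 (v v0))
    (t : R) (ht : 0 <= t) :
  ((1 - (2 * n).+1%:R `^ (- nu))%:E <
   KG_prob R m
     [set w | let v0 : obs R n := (GGmx m n sigma)^T *m cvec w in
              (normA (exact_average sigma Phi v0 t
                      - approx_average m sigma (v v0 t))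
               <= 23 / 10 * t / (2 * n).+1%:R `^ nu)%R])%E.
Proof.
have nm : (n <= m)%N by rewrite hm leq_addr.
set G := [set w | _].
pose p : R := (2 * n).+1%:R `^ nu; pose q : R := (2 * n).+1%:R.
have q3 : 3 <= q by rewrite ler_nat; lia.
have q0 : 0 < q by exact: lt_le_trans q3.
have p0 : 0 < p by rewrite powR_gt0.
pose K : R := 16 / 3 / (q ^+ 2 * p ^+ 3).
have K0 : 0 < K by rewrite divr_gt0// mulr_gt0 ?exprn_gt0.
pose a : R := 23 / 10; have a5 : 5 <= a ^+ 2 by rewrite /a; lra.
have a0 : 0 < a by rewrite divr_gt0.
(* [K] bounds [residual_const], and [H <= thr] amounts to [sqrt (K * H) <= a / p]. *)
pose thr := (a / p) ^+ 2 / K.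
have thr0 : 0 < thr.
  by apply: divr_gt0 => //; apply: exprn_gt0; exact: divr_gt0.
have event (w : (_.+1 + _.+1).-tuple (measurableTypeR R)) :
    ((cvec w)^T *m (GGmx m n sigma *m invmx (Mmx m n sigma) *m (GGmx m n sigma)^T)
       *m cvec w) 0 0 <= thr -> G w.
  rewrite observed_form /G /= => Hthr; set v0 := _ *m cvec w in Hthr *.
  have sw := width_ge3 hn hnu hwidth.
  apply: le_trans (averages_error nm sw hPhi (hv v0) ht) _.
  rewrite [leRHS]mulrAC; apply: ler_wpM2r => //.
  rewrite -[leRHS]ger0_norm ?divr_ge0 ?(ltW p0)// -sqrtr_sqr ler_wsqrtr//.
  rewrite -/p -/a -[leRHS](divfK (lt0r_neq0 K0)) mulrC.
  apply: ler_pM => //; first exact: Mmx_inv_form_ge0.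
    by rewrite !mulr_ge0 ?expR_ge0 ?ler0n.
  exact: residual_const_le.
rewrite /KG_prob Amx_diag.
apply: lt_le_trans (gauss_prob_quad (@energy_weights_ge1 R m) _ thr0 event); last first.
  by move=> z; rewrite observed_form Mmx_inv_form_ge0.
rewrite observed_form_trace// lte_fin ltrD2l ltrN2 powRN -/p.
have -> : ((2 * n).+1 + (2 * n).+1)%:R = 2 * q :> R by rewrite natrD /q; ring.
exact: markov_constant.
Qed.
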